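(* ($\mathsf{WKL}_0$) Every partial order with an infinite antichain contains an initial interval that is not a finite union of ideals.
   Context: Provability in $\mathsf{WKL}_0$. A partial order $(P,\preceq)$ has $P\subseteq\mathbb{N}$. An antichain is a set of pairwise incomparable elements. An initial interval of $P$ is $I\subseteq P$ with $x\preceq y\in I\Rightarrow x\in I$. An ideal is an initial interval $A$ such that for all $x,y\in A$ there is $z\in A$ with $x\preceq z$ and $y\preceq z$. *)

(* Defs.v *)
From Stdlib Require Import List Arith.
Import ListNotations.

(** * The two-sorted language of second-order arithmetic

    Two independent families of de Bruijn indices, one for number variables and
    one for set variables.  There are no set terms other than variables and no
    equality between sets. *)

Inductive term : Type :=
| TVar (n : nat)
| TZero
| TOne
| TAdd (t u : term)
| TMul (t u : term).

Inductive form : Type :=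
| FEq (t u : term)
| FLt (t u : term)
| FMem (t : term) (X : nat)
| FBot
| FImp (A B : form)
| FAnd (A B : form)
| FOr (A B : form)
| FAll1 (A : form)  (* number quantifiers *)
| FEx1 (A : form)
| FAll2 (A : form)  (* set quantifiers *)
| FEx2 (A : form).

Definition FNot (A : form) : form := FImp A FBot.
Definition FIff (A B : form) : form := FAnd (FImp A B) (FImp B A).

Definition scons {T : Type} (x : T) (s : nat -> T) (n : nat) : T :=
  match n with 0 => x | S k => s k end.

Fixpoint tsubst (s : nat -> term) (t : term) : term :=
  match t with
  | TVar n => s n
  | TZero => TZero
  | TOne => TOne
  | TAdd t u => TAdd (tsubst s t) (tsubst s u)
  | TMul t u => TMul (tsubst s t) (tsubst s u)
  end.

Definition tshift : term -> term := tsubst (fun k => TVar (S k)).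

Definition up1 (s : nat -> term) : nat -> term :=
  scons (TVar 0) (fun k => tshift (s k)).
Definition up2 (r : nat -> nat) : nat -> nat :=
  scons 0 (fun k => S (r k)).

Fixpoint fsubst (s : nat -> term) (r : nat -> nat) (A : form) : form :=
  match A with
  | FEq t u => FEq (tsubst s t) (tsubst s u)
  | FLt t u => FLt (tsubst s t) (tsubst s u)
  | FMem t X => FMem (tsubst s t) (r X)
  | FBot => FBot
  | FImp A B => FImp (fsubst s r A) (fsubst s r B)
  | FAnd A B => FAnd (fsubst s r A) (fsubst s r B)
  | FOr A B => FOr (fsubst s r A) (fsubst s r B)
  | FAll1 A => FAll1 (fsubst (up1 s) r A)
  | FEx1 A => FEx1 (fsubst (up1 s) r A)
  | FAll2 A => FAll2 (fsubst s (up2 r) A)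
  | FEx2 A => FEx2 (fsubst s (up2 r) A)
  end.

Definition shift1 : form -> form := fsubst (fun k => TVar (S k)) (fun X => X).
Definition shift2 : form -> form := fsubst TVar S.
Definition inst1 (t : term) : form -> form :=
  fsubst (scons t TVar) (fun X => X).
Definition inst2 (Y : nat) : form -> form :=
  fsubst TVar (scons Y (fun X => X)).

(** * Classical natural deduction with equality on numbers

    The generalization rules shift the hypotheses [G] but not the theory [T]:
    an axiom with free variables stands for its universal closure. *)

Inductive prv (T : form -> Prop) : list form -> form -> Prop :=
| prv_ax G A : T A -> prv T G A
| prv_hyp G A : In A G -> prv T G A
| prv_impI G A B : prv T (A :: G) B -> prv T G (FImp A B)
| prv_impE G A B : prv T G (FImp A B) -> prv T G A -> prv T G B
| prv_raa G A : prv T (FNot A :: G) FBot -> prv T G A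
| prv_andI G A B : prv T G A -> prv T G B -> prv T G (FAnd A B)
| prv_andE1 G A B : prv T G (FAnd A B) -> prv T G A
| prv_andE2 G A B : prv T G (FAnd A B) -> prv T G B
| prv_orI1 G A B : prv T G A -> prv T G (FOr A B)
| prv_orI2 G A B : prv T G B -> prv T G (FOr A B)
| prv_orE G A B C :
    prv T G (FOr A B) -> prv T (A :: G) C -> prv T (B :: G) C -> prv T G C
| prv_all1I G A : prv T (map shift1 G) A -> prv T G (FAll1 A)
| prv_all1E G A t : prv T G (FAll1 A) -> prv T G (inst1 t A)
| prv_ex1I G A t : prv T G (inst1 t A) -> prv T G (FEx1 A)
| prv_ex1E G A C :
    prv T G (FEx1 A) -> prv T (A :: map shift1 G) (shift1 C) -> prv T G C
| prv_all2I G A : prv T (map shift2 G) A -> prv T G (FAll2 A)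
| prv_all2E G A Y : prv T G (FAll2 A) -> prv T G (inst2 Y A)
| prv_ex2I G A Y : prv T G (inst2 Y A) -> prv T G (FEx2 A)
| prv_ex2E G A C :
    prv T G (FEx2 A) -> prv T (A :: map shift2 G) (shift2 C) -> prv T G C
| prv_eq_refl G t : prv T G (FEq t t)
| prv_eq_subst G A t u :
    prv T G (FEq t u) -> prv T G (inst1 t A) -> prv T G (inst1 u A).

(** * Writing formulas with named binders

    [tb], [sb] and [fb] are terms, set variables and formulas depending on the
    number of enclosing binders: [tb] and [sb] on the number of binders of their
    own sort, [fb] on both.  A binder passes to its body the variable it binds,
    which reads off its de Bruijn index from the depth at which it is used. *)

Definition tb : Type := nat -> term.
Definition sb : Type := nat -> nat.
Definition fb : Type := nat -> nat -> form.

Definition tzero : tb := fun _ => TZero.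
Definition tone : tb := fun _ => TOne.
Definition tadd (t u : tb) : tb := fun d => TAdd (t d) (u d).
Definition tmul (t u : tb) : tb := fun d => TMul (t d) (u d).

Definition feq (t u : tb) : fb := fun d e => FEq (t d) (u d).
Definition flt (t u : tb) : fb := fun d e => FLt (t d) (u d).
Definition fmem (t : tb) (X : sb) : fb := fun d e => FMem (t d) (X e).
Definition fnot (A : fb) : fb := fun d e => FNot (A d e).
Definition fimp (A B : fb) : fb := fun d e => FImp (A d e) (B d e).
Definition fand (A B : fb) : fb := fun d e => FAnd (A d e) (B d e).
Definition for_ (A B : fb) : fb := fun d e => FOr (A d e) (B d e).
Definition fiff (A B : fb) : fb := fun d e => FIff (A d e) (B d e).
Definition fall1 (A : tb -> fb) : fb :=
  fun d e => FAll1 (A (fun d' => TVar (d' - S d)) (S d) e).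
Definition fex1 (A : tb -> fb) : fb :=
  fun d e => FEx1 (A (fun d' => TVar (d' - S d)) (S d) e).
Definition fall2 (A : sb -> fb) : fb :=
  fun d e => FAll2 (A (fun e' => e' - S e) d (S e)).
Definition fex2 (A : sb -> fb) : fb :=
  fun d e => FEx2 (A (fun e' => e' - S e) d (S e)).

Definition close (A : fb) : form := A 0 0.

Definition provable (T : form -> Prop) (A : fb) : Prop := prv T [] (close A).

Declare Scope l2_scope.
Delimit Scope l2_scope with l2.
Bind Scope l2_scope with tb fb.
Notation "t + u" := (tadd t u) : l2_scope.
Notation "t * u" := (tmul t u) : l2_scope.
Notation "t = u" := (feq t u) : l2_scope.
Notation "t < u" := (flt t u) : l2_scope.
Notation "t 'el' X" := (fmem t X) (at level 70) : l2_scope.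
Notation "~ A" := (fnot A) : l2_scope.
Notation "A /\ B" := (fand A B) : l2_scope.
Notation "A \/ B" := (for_ A B) : l2_scope.
Notation "A -> B" := (fimp A B) : l2_scope.
Notation "A <-> B" := (fiff A B) : l2_scope.
Notation "'allN' x .. y , A" := (fall1 (fun x => .. (fall1 (fun y => A)) ..))
  (at level 10, x binder, y binder, A at level 200) : l2_scope.
Notation "'exN' x .. y , A" := (fex1 (fun x => .. (fex1 (fun y => A)) ..))
  (at level 10, x binder, y binder, A at level 200) : l2_scope.
Notation "'allS' X .. Y , A" := (fall2 (fun X => .. (fall2 (fun Y => A)) ..))
  (at level 10, X binder, Y binder, A at level 200) : l2_scope.
Notation "'exS' X .. Y , A" := (fex2 (fun X => .. (fex2 (fun Y => A)) ..))
  (at level 10, X binder, Y binder, A at level 200) : l2_scope.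

(** * RCA_0 *)

Inductive Sigma00 : form -> Prop :=
| Sigma00_eq t u : Sigma00 (FEq t u)
| Sigma00_lt t u : Sigma00 (FLt t u)
| Sigma00_mem t X : Sigma00 (FMem t X)
| Sigma00_bot : Sigma00 FBot
| Sigma00_imp A B : Sigma00 A -> Sigma00 B -> Sigma00 (FImp A B)
| Sigma00_and A B : Sigma00 A -> Sigma00 B -> Sigma00 (FAnd A B)
| Sigma00_or A B : Sigma00 A -> Sigma00 B -> Sigma00 (FOr A B)
| Sigma00_all t A :
    Sigma00 A -> Sigma00 (FAll1 (FImp (FLt (TVar 0) (tshift t)) A))
| Sigma00_ex t A :
    Sigma00 A -> Sigma00 (FEx1 (FAnd (FLt (TVar 0) (tshift t)) A)).

Inductive Sigma01 : form -> Prop :=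
| Sigma01_ex A : Sigma00 A -> Sigma01 (FEx1 A).

Inductive Pi01 : form -> Prop :=
| Pi01_all A : Sigma00 A -> Pi01 (FAll1 A).

(* In the schemes below the distinguished number variable of [A] has index 0;
   all other free variables are parameters. *)

Definition induction_axiom (A : form) : form :=
  FImp (FAnd (inst1 TZero A)
           (FAll1 (FImp A
              (fsubst (scons (TAdd (TVar 0) TOne) (fun k => TVar (S k)))
                      (fun X => X) A))))
      (FAll1 A).

Definition comprehension_axiom (A B : form) : form :=
  FImp (FAll1 (FIff A B)) (FEx2 (FAll1 (FIff (FMem (TVar 0) 0) (shift2 A)))).

Local Open Scope l2_scope.

Inductive RCA0 : form -> Prop :=
| RCA0_succ_neq0 : RCA0 (close (allN m, ~ (m + tone = tzero)))
| RCA0_succ_inj : RCA0 (close (allN m n, m + tone = n + tone -> m = n))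
| RCA0_add0 : RCA0 (close (allN m, m + tzero = m))
| RCA0_addS : RCA0 (close (allN m n, m + (n + tone) = (m + n) + tone))
| RCA0_mul0 : RCA0 (close (allN m, m * tzero = tzero))
| RCA0_mulS : RCA0 (close (allN m n, m * (n + tone) = m * n + m))
| RCA0_nlt0 : RCA0 (close (allN m, ~ (m < tzero)))
| RCA0_ltS : RCA0 (close (allN m n, m < n + tone <-> m < n \/ m = n))
| RCA0_induction A : Sigma01 A -> RCA0 (induction_axiom A)
| RCA0_comprehension A B :
    Sigma01 A -> Pi01 B -> RCA0 (comprehension_axiom A B).

(** * Finite sets and sequences in RCA_0

    Simpson's coding: (i, j) = (i + j)^2 + i; a number (k, (m, n)) represents
    the finite set of all i < k such that m(i + 1) + 1 divides n, and the code
    of a finite set is the least number representing it. *)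

Definition npair (i j : tb) : tb := (i + j) * (i + j) + i.

Definition fin_elem (i s : tb) : fb :=
  exN k m n, s = npair k (npair m n) /\ i < k /\
    (exN q, n = q * (m * (i + tone) + tone)).

Definition fin_repr (s : tb) : fb := exN k m n, s = npair k (npair m n).

Definition fin_code (s : tb) : fb :=
  fin_repr s /\
  (allN s', s' < s /\ fin_repr s' ->
    ~ (allN i, fin_elem i s' <-> fin_elem i s)).

Definition seq_length (s l : tb) : fb :=
  allN i, i < l <-> (exN j, fin_elem (npair i j) s).

Definition seq_code (s : tb) : fb :=
  fin_code s /\
  (allN x, fin_elem x s -> exN i j, x = npair i j) /\
  (allN i j k, fin_elem (npair i j) s /\ fin_elem (npair i k) s -> j = k) /\
  (exN l, seq_length s l).

Definition binary_seq (s : tb) : fb :=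
  seq_code s /\
  (allN i j, fin_elem (npair i j) s -> j = tzero \/ j = tone).

(* For sequences, inclusion of graphs is the initial segment relation. *)
Definition seq_incl (s t : tb) : fb := allN x, fin_elem x s -> fin_elem x t.

(** * Weak Koenig's lemma *)

Definition finite (X : sb) : fb := exN k, allN i, i el X -> i < k.
Definition infinite (X : sb) : fb := ~ finite X.

Definition binary_tree (T : sb) : fb :=
  (allN s, s el T -> binary_seq s) /\
  (allN s t, s el T /\ binary_seq t /\ seq_incl t s -> t el T).

Definition is_function (g : sb) : fb :=
  (allN x, x el g -> exN i j, x = npair i j) /\
  (allN i, exN j, npair i j el g) /\
  (allN i j k, npair i j el g /\ npair i k el g -> j = k).

(* s = <g(0), ..., g(n - 1)> *)
Definition restriction (g : sb) (n s : tb) : fb :=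
  seq_code s /\ seq_length s n /\ (allN x, fin_elem x s -> x el g).

Definition is_path (g T : sb) : fb :=
  is_function g /\ (allN n, exN s, restriction g n s /\ s el T).

Definition weak_koenig : fb :=
  allS T, binary_tree T /\ infinite T -> exS g, is_path g T.

Inductive WKL0 : form -> Prop :=
| WKL0_RCA0 A : RCA0 A -> WKL0 A
| WKL0_weak_koenig : WKL0 (close weak_koenig).

(** * Partial orders

    [P] is the underlying set and [R] the set of pairs (x, y) with x below y.
    Subsets of [P] are given as classes, so as to cover both set variables and
    the members of a coded sequence of sets. *)

Definition class : Type := tb -> fb.
Definition of_set (X : sb) : class := fun x => x el X.

(* The i-th set of the sequence of sets coded by A. *)
Definition nth_set (A : sb) (i : tb) : class := fun x => npair x i el A.

Definition partial_order (P R : sb) : fb :=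
  (allN z, z el R -> exN x y, x el P /\ y el P /\ z = npair x y) /\
  (allN x, x el P -> npair x x el R) /\
  (allN x y, npair x y el R /\ npair y x el R -> x = y) /\
  (allN x y z, npair x y el R /\ npair y z el R -> npair x z el R).

Definition antichain (P R D : sb) : fb :=
  (allN x, x el D -> x el P) /\
  (allN x y, x el D /\ y el D /\ ~ (x = y) ->
    ~ (npair x y el R) /\ ~ (npair y x el R)).

Definition initial_interval (P R : sb) (I : class) : fb :=
  (allN x, I x -> x el P) /\
  (allN x y, npair x y el R /\ I y -> I x).

Definition ideal (P R : sb) (A : class) : fb :=
  initial_interval P R A /\
  (allN x y, A x /\ A y -> exN z, A z /\ npair x z el R /\ npair y z el R).

Definition finite_union_of_ideals (P R : sb) (I : class) : fb :=
  exN k, exS A,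
    (allN i, i < k -> ideal P R (nth_set A i)) /\
    (allN x, I x <-> (exN i, i < k /\ nth_set A i x)).

(* Main.v *)
(** By completeness it suffices to argue in an arbitrary, possibly nonstandard, model
    of WKL_0; the countermodel for an unprovable formula is the Henkin term model.

    Let D be an infinite antichain of P. The binary sequences that look like the
    characteristic function of an initial interval containing D and no element strictly
    above an element of D form an infinite tree: on n, take the downward closure of the
    elements of D below n. A path is such an interval I. If x, y in D lie in a common
    ideal contained in I, an upper bound z of x and y in that ideal is in I, hence
    x = z = y. So if I were a union of k ideals, each would contain at most one element
    of D, and strong bounding for Sigma^0_1 formulas would bound D. *)

From Stdlib Require Import List Arith Lia Cantor.
From Stdlib Require Import Classical ClassicalEpsilon.
From Stdlib Require Import FunctionalExtensionality PropExtensionality.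
Require Import Defs.
Import ListNotations.

(** * Substitution *)

(** The downward closure of D and the class of points strictly above an element of D are disjoint,
    but only Sigma^0_1, so neither need exist as a set in RCA_0; the tree of finite characteristic
    functions turns the search for a set separating them into an instance of weak Koenig's lemma.
    Inside a model any Rocq predicate can be written down, but induction and comprehension apply
    only to definable ones; hence the calculus of [Def0] and [Def1], which supplies the formulas.
    The number k of ideals may be nonstandard, so no induction in the metatheory can exhaust them,
    and the class of those that meet D need not be treated as a set: the proof of strong bounding
    replaces it by a number, whose divisibility by pairwise coprime moduli, the same as those that
    code finite sets, records the indices still lacking a witness. *)

Lemma tsubst_comp s s' t : tsubst s' (tsubst s t) = tsubst (fun k => tsubst s' (s k)) t.
Proof. induction t; simpl; congruence. Qed.

Lemma tsubst_TVar t : tsubst TVar t = t.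
Proof. induction t; simpl; congruence. Qed.

Lemma up1_TVar : up1 TVar = TVar.
Proof. apply functional_extensionality; intros [|k]; reflexivity. Qed.

Lemma up2_id : up2 (fun X => X) = fun X => X.
Proof. apply functional_extensionality; intros [|k]; reflexivity. Qed.

Lemma up1_comp s s' : (fun k => tsubst (up1 s') (up1 s k)) = up1 (fun k => tsubst s' (s k)).
Proof.
  apply functional_extensionality; intros [|k]; [reflexivity|].
  cbn. unfold tshift. rewrite !tsubst_comp. reflexivity.
Qed.

Lemma up2_comp r r' : (fun k => up2 r' (up2 r k)) = up2 (fun k => r' (r k)).
Proof. apply functional_extensionality; intros [|k]; reflexivity. Qed.

Lemma fsubst_comp A : forall s r s' r',
  fsubst s' r' (fsubst s r A) = fsubst (fun k => tsubst s' (s k)) (fun X => r' (r X)) A.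
Proof.
  induction A; intros s r s' r'; simpl; rewrite ?tsubst_comp, ?IHA1, ?IHA2; try reflexivity.
  - rewrite IHA, up1_comp. reflexivity.
  - rewrite IHA, up1_comp. reflexivity.
  - rewrite IHA, up2_comp. reflexivity.
  - rewrite IHA, up2_comp. reflexivity.
Qed.

Lemma fsubst_id A : fsubst TVar (fun X => X) A = A.
Proof. induction A; simpl; rewrite ?tsubst_TVar, ?up1_TVar, ?up2_id; congruence. Qed.

Lemma fsubst_inst1 s r t A :
  fsubst s r (inst1 t A) = inst1 (tsubst s t) (fsubst (up1 s) r A).
Proof.
  unfold inst1. rewrite !fsubst_comp. f_equal.
  apply functional_extensionality; intros [|k]; [reflexivity|].
  cbn. unfold tshift. rewrite tsubst_comp. cbn. symmetry. apply tsubst_TVar.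
Qed.

Lemma fsubst_inst2 s r Y A :
  fsubst s r (inst2 Y A) = inst2 (r Y) (fsubst s (up2 r) A).
Proof.
  unfold inst2. rewrite !fsubst_comp. f_equal.
  - apply functional_extensionality; intros k. cbn. symmetry. apply tsubst_TVar.
  - apply functional_extensionality; intros [|k]; reflexivity.
Qed.

(** Merges instantiation and substitution into one simultaneous substitution, the form used to peel
    off generalized variables and to treat quantifiers in the truth lemma. *)
Lemma inst1_up1 s r t A :
  inst1 t (fsubst (up1 s) r A) = fsubst (scons t s) r A.
Proof.
  unfold inst1. rewrite fsubst_comp. f_equal.
  apply functional_extensionality; intros [|k]; [reflexivity|].
  cbn. unfold tshift. rewrite tsubst_comp. cbn. apply tsubst_TVar.
Qed.

Lemma inst2_up2 s r Y A :
  inst2 Y (fsubst s (up2 r) A) = fsubst s (scons Y r) A.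
Proof.
  unfold inst2. rewrite fsubst_comp. f_equal.
  - apply functional_extensionality; intros k. apply tsubst_TVar.
  - apply functional_extensionality; intros [|k]; reflexivity.
Qed.

Lemma fsubst_shift1 s r A : fsubst (up1 s) r (shift1 A) = shift1 (fsubst s r A).
Proof. unfold shift1. rewrite !fsubst_comp. reflexivity. Qed.

Lemma fsubst_shift2 s r A : fsubst s (up2 r) (shift2 A) = shift2 (fsubst s r A).
Proof.
  unfold shift2. rewrite !fsubst_comp. f_equal.
  apply functional_extensionality; intros k. cbn. symmetry. apply tsubst_TVar.
Qed.

Lemma map_fsubst_shift1 s r G :
  map (fsubst (up1 s) r) (map shift1 G) = map shift1 (map (fsubst s r) G).
Proof. rewrite !map_map. apply map_ext. intros A. apply fsubst_shift1. Qed.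

Lemma map_fsubst_shift2 s r G :
  map (fsubst s (up2 r)) (map shift2 G) = map shift2 (map (fsubst s r) G).
Proof. rewrite !map_map. apply map_ext. intros A. apply fsubst_shift2. Qed.

(* Strict upper bounds for the indices of the free variables of each sort. *)

Fixpoint tbound (t : term) : nat :=
  match t with
  | TVar n => S n
  | TZero | TOne => 0
  | TAdd t u | TMul t u => max (tbound t) (tbound u)
  end.

Fixpoint bound1 (A : form) : nat :=
  match A with
  | FEq t u | FLt t u => max (tbound t) (tbound u)
  | FMem t _ => tbound t
  | FBot => 0
  | FImp A B | FAnd A B | FOr A B => max (bound1 A) (bound1 B)
  | FAll1 A | FEx1 A => pred (bound1 A)
  | FAll2 A | FEx2 A => bound1 A
  end.

Fixpoint bound2 (A : form) : nat :=
  match A with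
  | FEq _ _ | FLt _ _ | FBot => 0
  | FMem _ X => S X
  | FImp A B | FAnd A B | FOr A B => max (bound2 A) (bound2 B)
  | FAll1 A | FEx1 A => bound2 A
  | FAll2 A | FEx2 A => pred (bound2 A)
  end.

Lemma tsubst_ext s s' t :
  (forall k, k < tbound t -> s k = s' k) -> tsubst s t = tsubst s' t.
Proof.
  induction t; simpl; intros H; auto; f_equal;
    (apply IHt1 || apply IHt2); intros; apply H; lia.
Qed.

Lemma up1_ext s s' n : (forall k, k < pred n -> s k = s' k) ->
  forall k, k < n -> up1 s k = up1 s' k.
Proof. intros H [|k] Hk; cbn; [reflexivity|]. rewrite H by lia. reflexivity. Qed.

Lemma up2_ext r r' n : (forall k, k < pred n -> r k = r' k) ->
  forall k, k < n -> up2 r k = up2 r' k.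
Proof. intros H [|k] Hk; cbn; [reflexivity|]. rewrite H by lia. reflexivity. Qed.

Lemma fsubst_ext A : forall s s' r r',
  (forall k, k < bound1 A -> s k = s' k) ->
  (forall k, k < bound2 A -> r k = r' k) ->
  fsubst s r A = fsubst s' r' A.
Proof.
  induction A; simpl; intros s s' r r' H1 H2; f_equal; auto;
    try (apply tsubst_ext; intros; apply H1; lia);
    try (apply H2; lia);
    try (apply IHA1; intros; (apply H1 || apply H2); lia);
    try (apply IHA2; intros; (apply H1 || apply H2); lia);
    apply IHA; auto; solve [eapply up1_ext; eauto | eapply up2_ext; eauto].
Qed.

(** * Structural properties of derivations *)

Section Derivations.
Variable T : form -> Prop.

Lemma prv_weakening G A : prv T G A -> forall G', incl G G' -> prv T G' A.
Proof.
  induction 1; intros G' HG.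
  - now apply prv_ax.
  - now apply prv_hyp, HG.
  - apply prv_impI, IHprv. intros C [|]; [now left|right; auto].
  - eapply prv_impE; eauto.
  - apply prv_raa, IHprv. intros C [|]; [now left|right; auto].
  - apply prv_andI; auto.
  - eapply prv_andE1; eauto.
  - eapply prv_andE2; eauto.
  - apply prv_orI1; auto.
  - apply prv_orI2; auto.
  - eapply prv_orE; eauto; [apply IHprv2|apply IHprv3];
      (intros D [|]; [now left|right; auto]).
  - apply prv_all1I, IHprv. now apply incl_map.
  - apply prv_all1E; auto.
  - eapply prv_ex1I; eauto.
  - eapply prv_ex1E; eauto. apply IHprv2. intros D [|]; [now left|].
    right. now apply (incl_map shift1 HG).
  - apply prv_all2I, IHprv. now apply incl_map.
  - apply prv_all2E; auto.
  - eapply prv_ex2I; eauto.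
  - eapply prv_ex2E; eauto. apply IHprv2. intros D [|]; [now left|].
    right. now apply (incl_map shift2 HG).
  - apply prv_eq_refl.
  - eapply prv_eq_subst; eauto.
Qed.

(* Peel off the substituted variables one at a time with generalization and
   instantiation; in the empty context generalization is unrestricted. *)
Lemma prv_nil_subst1 n : forall A s, prv T [] A ->
  (forall k, n <= k -> s k = TVar (k - n)) -> prv T [] (fsubst s (fun X => X) A).
Proof.
  induction n as [|n IH]; intros A s HA Hs.
  - replace s with TVar; [now rewrite fsubst_id|].
    apply functional_extensionality; intros k. rewrite Hs by lia. f_equal; lia.
  - pose proof (IH (FAll1 A) (fun k => s (S k)) (prv_all1I T [] A HA)) as H.
    assert (Hs' : forall k, n <= k -> s (S k) = TVar (k - n)).
    { intros k Hk. rewrite Hs by lia. f_equal; lia. }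
    apply H in Hs'. apply (prv_all1E _ _ _ (s 0)) in Hs'.
    rewrite inst1_up1 in Hs'. replace s with (scons (s 0) (fun k => s (S k))); auto.
    apply functional_extensionality; intros [|k]; reflexivity.
Qed.

Lemma prv_nil_subst2 n : forall A r, prv T [] A ->
  (forall k, n <= k -> r k = k - n) -> prv T [] (fsubst TVar r A).
Proof.
  induction n as [|n IH]; intros A r HA Hr.
  - replace r with (fun X : nat => X); [now rewrite fsubst_id|].
    apply functional_extensionality; intros k. rewrite Hr by lia. lia.
  - pose proof (IH (FAll2 A) (fun k => r (S k)) (prv_all2I T [] A HA)) as H.
    assert (Hr' : forall k, n <= k -> r (S k) = k - n).
    { intros k Hk. rewrite Hr by lia. lia. }
    apply H in Hr'. apply (prv_all2E _ _ _ (r 0)) in Hr'.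
    rewrite inst2_up2 in Hr'. replace r with (scons (r 0) (fun k => r (S k))); auto.
    apply functional_extensionality; intros [|k]; reflexivity.
Qed.

(** Only finitely many variables occur in [A], so beyond them [r] and [s] may be replaced by the
    shifts that the peeling lemmas require; set variables go first, and the number substitution then
    acts on the result. *)
Lemma prv_nil_subst A s r : prv T [] A -> prv T [] (fsubst s r A).
Proof.
  intros HA.
  set (r' := fun k => if k <? bound2 A then r k else k - bound2 A).
  assert (H2 : prv T [] (fsubst TVar r' A)).
  { apply prv_nil_subst2 with (bound2 A); auto. intros k Hk. unfold r'.
    destruct (Nat.ltb_spec k (bound2 A)); lia. }
  set (B := fsubst TVar r' A) in *.
  set (s' := fun k => if k <? bound1 B then s k else TVar (k - bound1 B)).
  assert (H1 : prv T [] (fsubst s' (fun X => X) B)).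
  { apply prv_nil_subst1 with (bound1 B); auto. intros k Hk. unfold s'.
    destruct (Nat.ltb_spec k (bound1 B)); [lia|reflexivity]. }
  replace (fsubst s r A) with (fsubst s' (fun X => X) B); auto.
  transitivity (fsubst s (fun X => X) B).
  - apply fsubst_ext; auto. intros k Hk. unfold s'.
    destruct (Nat.ltb_spec k (bound1 B)); [reflexivity|lia].
  - unfold B. rewrite fsubst_comp. apply fsubst_ext; auto. intros k Hk. unfold r'.
    destruct (Nat.ltb_spec k (bound2 A)); [reflexivity|lia].
Qed.

Lemma prv_subst G A : prv T G A -> forall s r,
  prv T (map (fsubst s r) G) (fsubst s r A).
Proof.
  induction 1; intros s r; simpl in *.
  (* An axiom stands for its universal closure, so its substitution instances are derivable in the
     empty context. *)
  - apply prv_weakening with []; [|intros ? []].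
    now apply prv_nil_subst, prv_ax.
  - now apply prv_hyp, in_map.
  - apply prv_impI; auto.
  - eapply prv_impE; [apply IHprv1|apply IHprv2].
  - apply prv_raa. apply IHprv.
  - apply prv_andI; auto.
  - eapply prv_andE1; apply IHprv.
  - eapply prv_andE2; apply IHprv.
  - apply prv_orI1; auto.
  - apply prv_orI2; auto.
  - eapply prv_orE; [apply IHprv1|apply IHprv2|apply IHprv3].
  - apply prv_all1I. rewrite <- map_fsubst_shift1. apply IHprv.
  - rewrite fsubst_inst1. apply prv_all1E, IHprv.
  - eapply prv_ex1I. rewrite <- fsubst_inst1. apply IHprv.
  - eapply prv_ex1E; [apply IHprv1|].
    rewrite <- map_fsubst_shift1, <- fsubst_shift1. apply IHprv2.
  - apply prv_all2I. rewrite <- map_fsubst_shift2. apply IHprv.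
  - rewrite fsubst_inst2. apply prv_all2E, IHprv.
  - eapply prv_ex2I. rewrite <- fsubst_inst2. apply IHprv.
  - eapply prv_ex2E; [apply IHprv1|].
    rewrite <- map_fsubst_shift2, <- fsubst_shift2. apply IHprv2.
  - apply prv_eq_refl.
  - rewrite fsubst_inst1. eapply prv_eq_subst; [apply IHprv1|].
    rewrite <- fsubst_inst1. apply IHprv2.
Qed.

Lemma prv_bot_elim G A : prv T G FBot -> prv T G A.
Proof.
  intros H. apply prv_raa. apply prv_weakening with G; auto. intros B; now right.
Qed.

(** Eigenvariable form of existential elimination: the renaming that sends the fresh variable [x] to
    index 0 and shifts all others turns the given derivation into the premise of [prv_ex1E]. *)
Lemma prv_fresh1 G C x :
  (forall B, In B G -> bound1 B <= x) -> bound1 (FEx1 C) <= x ->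
  prv T (inst1 (TVar x) C :: G) FBot -> prv T G (FEx1 C) -> prv T G FBot.
Proof.
  intros HG HC H HE. eapply prv_ex1E; [apply HE|].
  set (s := fun k => if k =? x then TVar 0 else TVar (S k)).
  apply (prv_subst _ _) with (s := s) (r := fun X => X) in H. simpl in H.
  replace (map (fsubst s (fun X => X)) G) with (map shift1 G) in H.
  - replace (fsubst s (fun X => X) (inst1 (TVar x) C)) with C in H; [exact H|].
    unfold inst1. rewrite fsubst_comp, <- (fsubst_id C) at 1.
    apply fsubst_ext; auto. intros [|k] Hk; cbn; unfold s.
    + now rewrite Nat.eqb_refl.
    + simpl in HC. destruct (Nat.eqb_spec k x); [lia|reflexivity].
  - apply map_ext_in. intros B HB. apply fsubst_ext; auto. intros k Hk. unfold s.
    specialize (HG B HB). destruct (Nat.eqb_spec k x); [lia|reflexivity].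
Qed.

Lemma prv_fresh2 G C x :
  (forall B, In B G -> bound2 B <= x) -> bound2 (FEx2 C) <= x ->
  prv T (inst2 x C :: G) FBot -> prv T G (FEx2 C) -> prv T G FBot.
Proof.
  intros HG HC H HE. eapply prv_ex2E; [apply HE|].
  set (r := fun k => if k =? x then 0 else S k).
  apply (prv_subst _ _) with (s := TVar) (r := r) in H. simpl in H.
  replace (map (fsubst TVar r) G) with (map shift2 G) in H.
  - replace (fsubst TVar r (inst2 x C)) with C in H; [exact H|].
    unfold inst2. rewrite fsubst_comp, <- (fsubst_id C) at 1.
    apply fsubst_ext; auto. intros [|k] Hk; cbn; unfold r.
    + now rewrite Nat.eqb_refl.
    + simpl in HC. destruct (Nat.eqb_spec k x); [lia|reflexivity].
  - apply map_ext_in. intros B HB. apply fsubst_ext; auto. intros k Hk. unfold r.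
    specialize (HG B HB). destruct (Nat.eqb_spec k x); [lia|reflexivity].
Qed.

End Derivations.

(** * Enumeration of formulas *)

Fixpoint decode_term (fuel n : nat) : term :=
  match fuel with
  | 0 => TZero
  | S f =>
    let (k, r) := of_nat n in
    let (a, b) := of_nat r in
    match k with
    | 0 => TVar r
    | 1 => TZero
    | 2 => TOne
    | 3 => TAdd (decode_term f a) (decode_term f b)
    | _ => TMul (decode_term f a) (decode_term f b)
    end
  end.

Fixpoint decode_form (fuel n : nat) : form :=
  match fuel with
  | 0 => FBot
  | S f =>
    let (k, r) := of_nat n in
    let (a, b) := of_nat r in
    match k with
    | 0 => FEq (decode_term f a) (decode_term f b)
    | 1 => FLt (decode_term f a) (decode_term f b)
    | 2 => FMem (decode_term f a) b
    | 3 => FBot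
    | 4 => FImp (decode_form f a) (decode_form f b)
    | 5 => FAnd (decode_form f a) (decode_form f b)
    | 6 => FOr (decode_form f a) (decode_form f b)
    | 7 => FAll1 (decode_form f a)
    | 8 => FEx1 (decode_form f a)
    | 9 => FAll2 (decode_form f a)
    | _ => FEx2 (decode_form f a)
    end
  end.

Definition code3 (k a b : nat) : nat := to_nat (k, to_nat (a, b)).

(** All sufficiently large fuels work, so that both parts of a compound term can be decoded with a
    common fuel. *)
Lemma decode_term_surj t : exists f0 n, forall f, f0 <= f -> decode_term f n = t.
Proof.
  induction t as [n| | |t [f1 [n1 H1]] u [f2 [n2 H2]]|t [f1 [n1 H1]] u [f2 [n2 H2]]].
  - exists 1, (to_nat (0, n)). intros [|f] Hf; [lia|]. cbn [decode_term].
    rewrite cancel_of_to. now destruct (of_nat n).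
  - exists 1, (code3 1 0 0). intros [|f] Hf; [lia|]. cbn [decode_term]. unfold code3.
    now rewrite !cancel_of_to.
  - exists 1, (code3 2 0 0). intros [|f] Hf; [lia|]. cbn [decode_term]. unfold code3.
    now rewrite !cancel_of_to.
  - exists (S (max f1 f2)), (code3 3 n1 n2). intros [|f] Hf; [lia|].
    cbn [decode_term]. unfold code3. rewrite !cancel_of_to, H1, H2 by lia. reflexivity.
  - exists (S (max f1 f2)), (code3 4 n1 n2). intros [|f] Hf; [lia|].
    cbn [decode_term]. unfold code3. rewrite !cancel_of_to, H1, H2 by lia. reflexivity.
Qed.

Ltac decode_case f0 k a b :=
  exists (S f0), (code3 k a b); intros [|f] Hf; [lia|];
  cbn [decode_form]; unfold code3; rewrite !cancel_of_to;
  repeat match goal with H : forall f, _ -> _ = _ |- _ => rewrite H by lia; clear H end;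
  reflexivity.

Lemma decode_form_surj A : exists f0 n, forall f, f0 <= f -> decode_form f n = A.
Proof.
  induction A as [t u|t u|t X| |A [f1 [n1 H1]] B [f2 [n2 H2]]|A [f1 [n1 H1]] B [f2 [n2 H2]]
    |A [f1 [n1 H1]] B [f2 [n2 H2]]|A [f1 [n1 H1]]|A [f1 [n1 H1]]|A [f1 [n1 H1]]|A [f1 [n1 H1]]].
  - destruct (decode_term_surj t) as [f1 [n1 H1]], (decode_term_surj u) as [f2 [n2 H2]].
    decode_case (max f1 f2) 0 n1 n2.
  - destruct (decode_term_surj t) as [f1 [n1 H1]], (decode_term_surj u) as [f2 [n2 H2]].
    decode_case (max f1 f2) 1 n1 n2.
  - destruct (decode_term_surj t) as [f1 [n1 H1]]. decode_case f1 2 n1 X.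
  - decode_case 0 3 0 0.
  - decode_case (max f1 f2) 4 n1 n2.
  - decode_case (max f1 f2) 5 n1 n2.
  - decode_case (max f1 f2) 6 n1 n2.
  - decode_case f1 7 n1 0.
  - decode_case f1 8 n1 0.
  - decode_case f1 9 n1 0.
  - decode_case f1 10 n1 0.
Qed.

Definition enum_form (n : nat) : form := let (f, m) := of_nat n in decode_form f m.

Lemma enum_form_surj A : exists n, enum_form n = A.
Proof.
  destruct (decode_form_surj A) as [f [n H]]. exists (to_nat (f, n)).
  unfold enum_form. rewrite cancel_of_to. now apply H.
Qed.

(** * Structures and satisfaction *)

(** Henkin semantics: set quantifiers range over an arbitrary type, with no extensionality
    condition, which makes this a two-sorted first-order logic with a completeness theorem. *)
Record structure : Type := {
  num : Type;
  nzero : num;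
  none : num;
  nadd : num -> num -> num;
  nmul : num -> num -> num;
  nlt : num -> num -> Prop;
  sets : Type;
  mem : num -> sets -> Prop }.

Fixpoint teval (M : structure) (rho : nat -> num M) (t : term) : num M :=
  match t with
  | TVar n => rho n
  | TZero => nzero M
  | TOne => none M
  | TAdd t u => nadd M (teval M rho t) (teval M rho u)
  | TMul t u => nmul M (teval M rho t) (teval M rho u)
  end.

Fixpoint sat (M : structure) (rho : nat -> num M) (sig : nat -> sets M) (A : form)
  {struct A} : Prop :=
  match A with
  | FEq t u => teval M rho t = teval M rho u
  | FLt t u => nlt M (teval M rho t) (teval M rho u)
  | FMem t X => mem M (teval M rho t) (sig X)
  | FBot => False
  | FImp A B => sat M rho sig A -> sat M rho sig B
  | FAnd A B => sat M rho sig A /\ sat M rho sig B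
  | FOr A B => sat M rho sig A \/ sat M rho sig B
  | FAll1 A => forall x, sat M (scons x rho) sig A
  | FEx1 A => exists x, sat M (scons x rho) sig A
  | FAll2 A => forall X, sat M rho (scons X sig) A
  | FEx2 A => exists X, sat M rho (scons X sig) A
  end.

Definition models (M : structure) (T : form -> Prop) : Prop :=
  forall A, T A -> forall rho sig, sat M rho sig A.

Lemma teval_subst M rho s t :
  teval M rho (tsubst s t) = teval M (fun k => teval M rho (s k)) t.
Proof. induction t; simpl; congruence. Qed.

Lemma scons_up1 M rho s x :
  (fun k => teval M (scons x rho) (up1 s k)) = scons x (fun k => teval M rho (s k)).
Proof.
  apply functional_extensionality; intros [|k]; [reflexivity|]. cbn.
  unfold tshift. now rewrite teval_subst.
Qed.

Lemma scons_up2 {T : Type} (sig : nat -> T) r X :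
  (fun k => scons X sig (up2 r k)) = scons X (fun k => sig (r k)).
Proof. apply functional_extensionality; intros [|k]; reflexivity. Qed.

Lemma sat_subst M A : forall rho sig s r,
  sat M rho sig (fsubst s r A) <->
  sat M (fun k => teval M rho (s k)) (fun X => sig (r X)) A.
Proof.
  induction A; intros rho sig s r; simpl; rewrite ?teval_subst;
    try rewrite IHA1, IHA2; try tauto.
  - split; intros H x; specialize (H x); revert H; rewrite IHA, scons_up1; auto.
  - split; intros [x H]; exists x; revert H; rewrite IHA, scons_up1; auto.
  - split; intros H x; specialize (H x); revert H; rewrite IHA, scons_up2; auto.
  - split; intros [x H]; exists x; revert H; rewrite IHA, scons_up2; auto.
Qed.

(** * Completeness *)

Section Completeness.
Variables (T : form -> Prop) (A0 : form).
Hypothesis A0_unprovable : ~ prv T [] A0.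

Definition consistent (G : list form) : Prop := ~ prv T G FBot.

Definition fresh (f : form -> nat) (G : list form) : nat :=
  fold_right (fun A n => max (f A) n) 0 G.

Lemma fresh_spec f G A : In A G -> f A <= fresh f G.
Proof.
  induction G as [|B G IH]; simpl; [tauto|]. intros [->|H]; [lia|].
  apply IH in H. lia.
Qed.

(** Only the formula just added at the head can need a witness; the variable is chosen past all free
    variables of its sort in the whole list. *)
Definition add_witness (G : list form) : list form :=
  match G with
  | FEx1 C :: _ => inst1 (TVar (fresh bound1 G)) C :: G
  | FEx2 C :: _ => inst2 (fresh bound2 G) C :: G
  | _ => G
  end.

Fixpoint henkin (n : nat) : list form :=
  match n with
  | 0 => [FNot A0]
  | S n => if excluded_middle_informative (consistent (enum_form n :: henkin n))
           then add_witness (enum_form n :: henkin n) else henkin n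
  end.

Lemma add_witness_incl G : incl G (add_witness G).
Proof.
  unfold add_witness. destruct G as [|[]]; intros ?; auto; now right.
Qed.

Lemma add_witness_consistent G : consistent G -> consistent (add_witness G).
Proof.
  intros HG. destruct G as [|[] G]; auto.
  - intros H. apply HG. eapply prv_fresh1 in H; eauto.
    + intros B HB. now apply fresh_spec.
    + apply fresh_spec. now left.
    + apply prv_hyp. now left.
  - intros H. apply HG. eapply prv_fresh2 in H; eauto.
    + intros B HB. now apply fresh_spec.
    + apply fresh_spec. now left.
    + apply prv_hyp. now left.
Qed.

Lemma henkin_consistent n : consistent (henkin n).
Proof.
  induction n as [|n IH]; cbn [henkin].
  - intros H. now apply A0_unprovable, prv_raa.
  - destruct (excluded_middle_informative _); auto using add_witness_consistent.
Qed.

Lemma henkin_mono n m : n <= m -> incl (henkin n) (henkin m).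
Proof.
  induction 1 as [|m Hm IH]; [apply incl_refl|]. cbn [henkin].
  destruct (excluded_middle_informative _); auto.
  intros B HB. apply add_witness_incl. right. auto.
Qed.

(** Derivability from some stage of the Henkin construction. As the stages increase, this is closed
    under deduction; the lemmas below show that it obeys Tarski's clauses. *)
Definition thm (A : form) : Prop := exists n, prv T (henkin n) A.

Lemma thm_max n m A : prv T (henkin n) A -> prv T (henkin (max n m)) A.
Proof. intros H. apply prv_weakening with (henkin n); auto. apply henkin_mono; lia. Qed.

Lemma thm_lift A B : (forall G, prv T G A -> prv T G B) -> thm A -> thm B.
Proof. intros H [n Hn]. exists n. auto. Qed.

Lemma thm_lift2 A B C :
  (forall G, prv T G A -> prv T G B -> prv T G C) -> thm A -> thm B -> thm C.
Proof.
  intros H [n Hn] [m Hm]. exists (max n m). apply H.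
  - now apply thm_max.
  - rewrite Nat.max_comm. now apply thm_max.
Qed.

Lemma thm_bot : ~ thm FBot.
Proof. intros [n H]. now apply (henkin_consistent n). Qed.

Lemma thm_not A : thm (FNot A) <-> ~ thm A.
Proof.
  split.
  - intros H1 H2. apply thm_bot. revert H1 H2. apply thm_lift2.
    intros G. apply prv_impE.
  - intros H. destruct (enum_form_surj A) as [n Hn]. exists (S n). cbn [henkin]. rewrite Hn.
    destruct (excluded_middle_informative _) as [HC|HC].
    (* Being consistent with its stage, [A] was added there and is a theorem after all. *)
    + destruct H. exists (S n). cbn [henkin]. rewrite Hn.
      destruct (excluded_middle_informative _); [|tauto].
      apply prv_hyp, add_witness_incl. now left.
    + apply prv_impI. now apply NNPP in HC.
Qed.

Lemma thm_imp A B : thm (FImp A B) <-> (thm A -> thm B).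
Proof.
  split; [apply thm_lift2; intros G; apply prv_impE|].
  intros H. destruct (classic (thm A)) as [HA|HA].
  - generalize (H HA). apply thm_lift. intros G HB. apply prv_impI.
    apply prv_weakening with G; auto. intros C; now right.
  - apply thm_not in HA. revert HA. apply thm_lift. intros G HA. apply prv_impI.
    apply prv_bot_elim. apply prv_impE with A; [|apply prv_hyp; now left].
    apply prv_weakening with G; auto. intros C; now right.
Qed.

Lemma thm_and A B : thm (FAnd A B) <-> thm A /\ thm B.
Proof.
  split.
  - intros H. split; revert H; apply thm_lift; intros G.
    + apply prv_andE1.
    + apply prv_andE2.
  - intros [HA HB]. revert HA HB. apply thm_lift2. intros G. apply prv_andI.
Qed.

Lemma thm_or A B : thm (FOr A B) <-> thm A \/ thm B.
Proof.
  split.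
  - intros H. destruct (classic (thm A)) as [|HA]; [now left|]. right.
    apply thm_not in HA. revert H HA. apply thm_lift2. intros G HO HA.
    apply prv_orE with A B; auto; [|apply prv_hyp; now left].
    apply prv_bot_elim. apply prv_impE with A; [|apply prv_hyp; now left].
    apply prv_weakening with G; auto. intros C; now right.
  - intros [H|H]; revert H; apply thm_lift; intros G.
    + apply prv_orI1.
    + apply prv_orI2.
Qed.

(** A theorem is consistent with every stage, hence it is added when its turn comes, together with
    its witness. *)
Lemma thm_witness A : thm A ->
  exists n, incl (add_witness (A :: henkin n)) (henkin (S n)).
Proof.
  intros H. destruct (enum_form_surj A) as [n Hn]. exists n. cbn [henkin]. rewrite Hn.
  destruct (excluded_middle_informative _) as [|HC]; [apply incl_refl|].
  apply NNPP in HC. destruct thm_bot. revert H. apply thm_lift2 with (FNot A).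
  - intros G. apply prv_impE.
  - exists n. now apply prv_impI.
Qed.

Lemma thm_ex1 A : thm (FEx1 A) <-> exists t, thm (inst1 t A).
Proof.
  split.
  - intros H. apply thm_witness in H as [n H]. eexists. exists (S n).
    apply prv_hyp, H. simpl. left. reflexivity.
  - intros [t H]. revert H. apply thm_lift. intros G. apply prv_ex1I.
Qed.

Lemma thm_ex2 A : thm (FEx2 A) <-> exists Y, thm (inst2 Y A).
Proof.
  split.
  - intros H. apply thm_witness in H as [n H]. eexists. exists (S n).
    apply prv_hyp, H. simpl. left. reflexivity.
  - intros [t H]. revert H. apply thm_lift. intros G. apply prv_ex2I.
Qed.

(** For the converse, classical logic turns the failure of [thm (FAll1 A)] into the theorem
    [FEx1 (FNot A)], whose witness refutes an instance. *)
Lemma thm_all1 A : thm (FAll1 A) <-> forall t, thm (inst1 t A).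
Proof.
  split; [intros H t; revert H; apply thm_lift; intros G; apply prv_all1E|].
  intros H. apply NNPP. intros HN. apply thm_not in HN.
  assert (HE : thm (FEx1 (FNot A))).
  { revert HN. apply thm_lift. intros G HG. apply prv_raa.
    apply prv_impE with (FAll1 A).
    - apply prv_weakening with G; auto. intros C; now right.
    - apply prv_all1I, prv_raa. simpl.
      apply prv_impE with (shift1 (FEx1 (FNot A))); [apply prv_hyp; right; now left|].
      apply prv_ex1I with (TVar 0).
      replace (inst1 _ _) with (FNot A); [apply prv_hyp; now left|].
      symmetry. unfold shift1. change (FNot (inst1 (TVar 0)
        (fsubst (up1 (fun k => TVar (S k))) (fun X => X) A)) = FNot A).
      f_equal. rewrite inst1_up1. etransitivity; [|apply fsubst_id]. f_equal.
      apply functional_extensionality; intros [|k]; reflexivity. }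
  apply thm_ex1 in HE as [t Ht]. change (thm (FNot (inst1 t A))) in Ht.
  apply thm_not in Ht. apply Ht, H.
Qed.

Lemma thm_all2 A : thm (FAll2 A) <-> forall Y, thm (inst2 Y A).
Proof.
  split; [intros H t; revert H; apply thm_lift; intros G; apply prv_all2E|].
  intros H. apply NNPP. intros HN. apply thm_not in HN.
  assert (HE : thm (FEx2 (FNot A))).
  { revert HN. apply thm_lift. intros G HG. apply prv_raa.
    apply prv_impE with (FAll2 A).
    - apply prv_weakening with G; auto. intros C; now right.
    - apply prv_all2I, prv_raa. simpl.
      apply prv_impE with (shift2 (FEx2 (FNot A))); [apply prv_hyp; right; now left|].
      apply prv_ex2I with 0.
      replace (inst2 _ _) with (FNot A); [apply prv_hyp; now left|].
      symmetry. unfold shift2. change (FNot (inst2 0 (fsubst TVar (up2 S) A)) = FNot A).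
      f_equal. rewrite inst2_up2. etransitivity; [|apply fsubst_id]. f_equal.
      apply functional_extensionality; intros [|k]; reflexivity. }
  apply thm_ex2 in HE as [t Ht]. change (thm (FNot (inst2 t A))) in Ht.
  apply thm_not in Ht. apply Ht, H.
Qed.

Lemma thm_eq_subst A s r t u :
  thm (FEq t u) -> thm (fsubst (scons t s) r A) -> thm (fsubst (scons u s) r A).
Proof. rewrite <- !inst1_up1. apply thm_lift2. intros G. apply prv_eq_subst. Qed.

(** * The term model modulo provable equality *)

Definition teq (t u : term) : Prop := thm (FEq t u).

Lemma teq_refl t : teq t t.
Proof. exists 0. apply prv_eq_refl. Qed.

Lemma teq_sym t u : teq t u -> teq u t.
Proof.
  intros H. apply (thm_eq_subst (FEq (TVar 0) (TVar 1)) (fun _ => t) (fun X => X) t u H).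
  apply teq_refl.
Qed.

Lemma teq_trans t u v : teq t u -> teq u v -> teq t v.
Proof.
  intros H1 H2.
  exact (thm_eq_subst (FEq (TVar 1) (TVar 0)) (fun _ => t) (fun X => X) u v H2 H1).
Qed.

(** A chosen representative of each class presents the quotient as a subtype, so that equality in
    the model is Rocq's equality, as the clause for [FEq] demands. *)
Definition rep (t : term) : term := epsilon (inhabits TZero) (teq t).

Lemma teq_rep t : teq t (rep t).
Proof. apply (epsilon_spec (inhabits TZero) (teq t)). exists t. apply teq_refl. Qed.

Lemma rep_eq t u : rep t = rep u <-> teq t u.
Proof.
  split; intros H.
  - apply teq_trans with (rep t); [apply teq_rep|]. rewrite H. apply teq_sym, teq_rep.
  (* Equivalent terms give the same predicate, and [epsilon] depends only on the predicate. *)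
  - unfold rep. f_equal. apply functional_extensionality; intros v.
    apply propositional_extensionality.
    split; intros H'; eauto using teq_trans, teq_sym.
Qed.

Definition tclass : Type := {t : term | rep t = t}.

Definition cls (t : term) : tclass :=
  exist (fun t => rep t = t) (rep t) (proj2 (rep_eq (rep t) t) (teq_sym _ _ (teq_rep t))).

Lemma cls_eq t u : cls t = cls u <-> teq t u.
Proof.
  rewrite <- rep_eq. split; intros H.
  - exact (f_equal (@proj1_sig _ _) H).
  - apply eq_sig_hprop; [intros; apply proof_irrelevance|exact H].
Qed.

Lemma cls_surj (x : tclass) : exists t, x = cls t.
Proof.
  destruct x as [t Ht]. exists t.
  apply eq_sig_hprop; [intros; apply proof_irrelevance|now symmetry].
Qed.

(** Sets are names of set variables and are not identified with one another, as the language has no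
    equality between sets. *)
Definition term_model : structure := {|
  num := tclass;
  nzero := cls TZero;
  none := cls TOne;
  nadd := fun x y => cls (TAdd (proj1_sig x) (proj1_sig y));
  nmul := fun x y => cls (TMul (proj1_sig x) (proj1_sig y));
  nlt := fun x y => thm (FLt (proj1_sig x) (proj1_sig y));
  sets := nat;
  mem := fun x X => thm (FMem (proj1_sig x) X) |}.

Lemma teq_TAdd t t' u u' : teq t t' -> teq u u' -> teq (TAdd t u) (TAdd t' u').
Proof.
  intros Ht Hu. apply teq_trans with (TAdd t' u).
  - apply (thm_eq_subst (FEq (TAdd (TVar 1) (TVar 2)) (TAdd (TVar 0) (TVar 2)))
      (scons t (fun _ => u)) (fun X => X) t t' Ht). apply teq_refl.
  - apply (thm_eq_subst (FEq (TAdd (TVar 2) (TVar 1)) (TAdd (TVar 2) (TVar 0)))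
      (scons u (fun _ => t')) (fun X => X) u u' Hu). apply teq_refl.
Qed.

Lemma teq_TMul t t' u u' : teq t t' -> teq u u' -> teq (TMul t u) (TMul t' u').
Proof.
  intros Ht Hu. apply teq_trans with (TMul t' u).
  - apply (thm_eq_subst (FEq (TMul (TVar 1) (TVar 2)) (TMul (TVar 0) (TVar 2)))
      (scons t (fun _ => u)) (fun X => X) t t' Ht). apply teq_refl.
  - apply (thm_eq_subst (FEq (TMul (TVar 2) (TVar 1)) (TMul (TVar 2) (TVar 0)))
      (scons u (fun _ => t')) (fun X => X) u u' Hu). apply teq_refl.
Qed.

Lemma thm_FLt_congr t t' u u' : teq t t' -> teq u u' -> thm (FLt t u) -> thm (FLt t' u').
Proof.
  intros Ht Hu H.
  apply (thm_eq_subst (FLt (TVar 0) (TVar 1)) (fun _ => u') (fun X => X) t t' Ht).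
  exact (thm_eq_subst (FLt (TVar 1) (TVar 0)) (fun _ => t) (fun X => X) u u' Hu H).
Qed.

Lemma thm_FMem_congr t t' X : teq t t' -> thm (FMem t X) -> thm (FMem t' X).
Proof. exact (thm_eq_subst (FMem (TVar 0) X) TVar (fun X => X) t t'). Qed.

Lemma teval_term_model s t :
  teval term_model (fun k => cls (s k)) t = cls (tsubst s t).
Proof.
  induction t as [n| | |t IHt u IHu|t IHt u IHu]; simpl; try reflexivity; rewrite IHt, IHu.
  - apply cls_eq, teq_TAdd; apply teq_sym, teq_rep.
  - apply cls_eq, teq_TMul; apply teq_sym, teq_rep.
Qed.

Lemma cls_scons t s : scons (cls t) (fun k => cls (s k)) = fun k => cls (scons t s k).
Proof. apply functional_extensionality; intros [|k]; reflexivity. Qed.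

Lemma sat_term_model A : forall s r,
  sat term_model (fun k => cls (s k)) r A <-> thm (fsubst s r A).
Proof.
  induction A; intros s r; cbn [sat fsubst]; rewrite ?teval_term_model.
  - apply cls_eq.
  - split; apply thm_FLt_congr; auto using teq_rep, teq_sym.
  - split; apply thm_FMem_congr; auto using teq_rep, teq_sym.
  - split; [tauto|apply thm_bot].
  - rewrite thm_imp, IHA1, IHA2. tauto.
  - rewrite thm_and, IHA1, IHA2. tauto.
  - rewrite thm_or, IHA1, IHA2. tauto.
  - rewrite thm_all1. split; intros H.
    + intros t. rewrite inst1_up1, <- IHA, <- cls_scons. apply H.
    + intros x. destruct (cls_surj x) as [t ->].
      rewrite cls_scons, IHA, <- inst1_up1. apply H.
  - rewrite thm_ex1. split.
    + intros [x H]. destruct (cls_surj x) as [t ->]. exists t.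
      now rewrite inst1_up1, <- IHA, <- cls_scons.
    + intros [t H]. exists (cls t). now rewrite cls_scons, IHA, <- inst1_up1.
  - rewrite thm_all2. split; intros H Y.
    + rewrite inst2_up2, <- IHA. apply H.
    + rewrite IHA, <- inst2_up2. apply H.
  - rewrite thm_ex2. split; intros [Y H]; exists Y.
    + now rewrite inst2_up2, <- IHA.
    + now rewrite IHA, <- inst2_up2.
Qed.

Lemma term_model_models : models term_model T.
Proof.
  intros A HA rho sig.
  (* Every assignment comes from a substitution, so truth of an axiom under it amounts to
     derivability of a substitution instance. *)
  assert (Hrho : exists s, rho = fun k => cls (s k)).
  { exists (fun k => proj1_sig (rho k)). apply functional_extensionality; intros k.
    destruct (cls_surj (rho k)) as [t Ht]. rewrite Ht. apply cls_eq, teq_rep. }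
  destruct Hrho as [s ->]. apply sat_term_model. exists 0.
  apply prv_weakening with []; [|intros ? []]. now apply prv_nil_subst, prv_ax.
Qed.

Lemma term_model_refutes : ~ sat term_model (fun k => cls (TVar k)) (fun X => X) A0.
Proof.
  rewrite sat_term_model, fsubst_id. apply thm_not. exists 0. apply prv_hyp. now left.
Qed.

End Completeness.

Theorem completeness T A :
  (forall M, models M T -> forall rho sig, sat M rho sig A) -> prv T [] A.
Proof.
  intros H. apply NNPP. intros HA. apply (term_model_refutes T A HA), H.
  now apply term_model_models.
Qed.

(** * Definability in a structure *)

Lemma Sigma00_subst A : Sigma00 A -> forall s r, Sigma00 (fsubst s r A).
Proof.
  assert (E : forall s t, tsubst (up1 s) (tshift t) = tshift (tsubst s t)).
  { intros s t. unfold tshift. now rewrite !tsubst_comp. }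
  induction 1; intros s r; cbn [fsubst tsubst]; rewrite ?E; constructor; auto.
Qed.

Section Definability.
Variable M : structure.
Notation N := (num M).

Fixpoint tup (n : nat) : Type :=
  match n with 0 => unit | S n => (tup n * N)%type end.

(** The last component of the tuple is variable 0, so that a quantifier extends the tuple on the
    right; variables from [n] on are parameters. *)
Fixpoint env (n : nat) (c : nat -> N) : tup n -> nat -> N :=
  match n with
  | 0 => fun _ => c
  | S n => fun g => scons (snd g) (env n c (fst g))
  end.

(* Definability with parameters: [c] and [sig] supply the number and set parameters. *)

Definition DefT (n : nat) (f : tup n -> N) : Prop :=
  exists t c, forall g, teval M (env n c g) t = f g.

Definition Def0 (n : nat) (phi : tup n -> Prop) : Prop :=
  exists A c sig, Sigma00 A /\ forall g, sat M (env n c g) sig A <-> phi g.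

Definition Def1 (n : nat) (phi : tup n -> Prop) : Prop :=
  exists psi, Def0 (S n) psi /\ forall g, phi g <-> exists x, psi (g, x).

(** Two formulas with different parameters are brought to a common assignment by moving those of one
    to even indices and those of the other to odd ones. *)
Definition interleave {T : Type} (a b : nat -> T) (k : nat) : T :=
  if Nat.even k then a (Nat.div2 k) else b (Nat.div2 k).

Lemma interleave_even {T : Type} (a b : nat -> T) k : interleave a b (2 * k) = a k.
Proof. unfold interleave. now rewrite Nat.even_even, Nat.div2_double. Qed.

Lemma interleave_odd {T : Type} (a b : nat -> T) k : interleave a b (S (2 * k)) = b k.
Proof.
  unfold interleave. replace (Nat.even (S (2 * k))) with false; [now rewrite Nat.div2_succ_double|].
  symmetry. rewrite Nat.even_succ, <- Nat.negb_even, Nat.even_even. reflexivity.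
Qed.

Lemma env_low n c c' g k : k < n -> env n c g k = env n c' g k.
Proof.
  revert k. induction n as [|n IH]; intros k Hk; [lia|].
  destruct k as [|k]; cbn; [reflexivity|]. apply IH. lia.
Qed.

Lemma env_high n c g k : env n c g (n + k) = c k.
Proof. induction n as [|n IH]; cbn; auto. Qed.

Lemma env_rename n c c' f : (forall k, c' (f k) = c k) ->
  exists s, forall g, (fun k => teval M (env n c' g) (s k)) = env n c g.
Proof.
  intros H. exists (fun k => TVar (if k <? n then k else n + f (k - n))). intros g.
  apply functional_extensionality; intros k. cbn [teval].
  destruct (Nat.ltb_spec k n) as [Hk|Hk]; [now apply env_low|].
  rewrite env_high, H. replace k with (n + (k - n)) at 2 by lia. now rewrite env_high.
Qed.

Lemma env_merge n c1 c2 : exists c s1 s2, forall g,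
  (fun k => teval M (env n c g) (s1 k)) = env n c1 g /\
  (fun k => teval M (env n c g) (s2 k)) = env n c2 g.
Proof.
  destruct (env_rename n c1 (interleave c1 c2) (fun k => 2 * k)) as [s1 H1];
    [apply interleave_even|].
  destruct (env_rename n c2 (interleave c1 c2) (fun k => S (2 * k))) as [s2 H2];
    [apply interleave_odd|].
  exists (interleave c1 c2), s1, s2. auto.
Qed.

Lemma sig_merge {T : Type} (sig1 sig2 : nat -> T) :
  exists (sig : nat -> T) (r1 r2 : nat -> nat),
  (fun k => sig (r1 k)) = sig1 /\ (fun k => sig (r2 k)) = sig2.
Proof.
  exists (interleave sig1 sig2), (fun k => 2 * k), (fun k => S (2 * k)).
  split; apply functional_extensionality; intros k.
  - apply interleave_even.
  - apply interleave_odd.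
Qed.

Lemma DefT_merge n f f' : DefT n f -> DefT n f' -> exists c t t', forall g,
  teval M (env n c g) t = f g /\ teval M (env n c g) t' = f' g.
Proof.
  intros [t [c H]] [t' [c' H']]. destruct (env_merge n c c') as [c0 [s [s' E]]].
  exists c0, (tsubst s t), (tsubst s' t'). intros g. destruct (E g) as [E1 E2].
  now rewrite !teval_subst, E1, E2, H, H'.
Qed.

Lemma DefT_const n a : DefT n (fun _ => a).
Proof.
  exists (TVar (n + 0)), (fun _ => a). intros g. cbn. apply env_high.
Qed.

Lemma DefT_add n f f' : DefT n f -> DefT n f' -> DefT n (fun g => nadd M (f g) (f' g)).
Proof.
  intros H H'. destruct (DefT_merge n f f' H H') as [c [t [t' E]]].
  exists (TAdd t t'), c. intros g. cbn. destruct (E g). congruence.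
Qed.

Lemma DefT_mul n f f' : DefT n f -> DefT n f' -> DefT n (fun g => nmul M (f g) (f' g)).
Proof.
  intros H H'. destruct (DefT_merge n f f' H H') as [c [t [t' E]]].
  exists (TMul t t'), c. intros g. cbn. destruct (E g). congruence.
Qed.

Lemma DefT_fst n f : DefT n f -> DefT (S n) (fun g => f (fst g)).
Proof.
  intros [t [c H]]. exists (tshift t), c. intros g. unfold tshift.
  rewrite teval_subst, <- H. reflexivity.
Qed.

Lemma DefT_v0 n : DefT (S n) (fun g => snd g).
Proof. exists (TVar 0), (fun _ => nzero M). reflexivity. Qed.

Lemma DefT_v1 n : DefT (S (S n)) (fun g => snd (fst g)).
Proof. apply (DefT_fst _ (fun g : tup (S n) => snd g)), DefT_v0. Qed.

Lemma DefT_v2 n : DefT (S (S (S n))) (fun g => snd (fst (fst g))).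
Proof. apply (DefT_fst _ (fun g : tup (S (S n)) => snd (fst g))), DefT_v1. Qed.

Lemma DefT_v3 n : DefT (S (S (S (S n)))) (fun g => snd (fst (fst (fst g)))).
Proof. apply (DefT_fst _ (fun g : tup (S (S (S n))) => snd (fst (fst g)))), DefT_v2. Qed.

Lemma DefT_v4 n : DefT (S (S (S (S (S n))))) (fun g => snd (fst (fst (fst (fst g))))).
Proof.
  apply (DefT_fst _ (fun g : tup (S (S (S (S n)))) => snd (fst (fst (fst g))))), DefT_v3.
Qed.

Lemma Def0_ext n (phi psi : tup n -> Prop) :
  (forall g, phi g <-> psi g) -> Def0 n phi -> Def0 n psi.
Proof.
  intros H [A [c [sig [HA E]]]]. exists A, c, sig. split; auto.
  intros g. rewrite E. apply H.
Qed.

Lemma Def0_eq (X0 : sets M) n f f' : DefT n f -> DefT n f' -> Def0 n (fun g => f g = f' g).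
Proof.
  intros H H'. destruct (DefT_merge n f f' H H') as [c [t [t' E]]].
  exists (FEq t t'), c, (fun _ => X0). split; [constructor|].
  intros g. cbn. destruct (E g) as [-> ->]. tauto.
Qed.

Lemma Def0_lt (X0 : sets M) n f f' : DefT n f -> DefT n f' -> Def0 n (fun g => nlt M (f g) (f' g)).
Proof.
  intros H H'. destruct (DefT_merge n f f' H H') as [c [t [t' E]]].
  exists (FLt t t'), c, (fun _ => X0). split; [constructor|].
  intros g. cbn. destruct (E g) as [-> ->]. tauto.
Qed.

Lemma Def0_mem n f X : DefT n f -> Def0 n (fun g => mem M (f g) X).
Proof.
  intros [t [c H]]. exists (FMem t 0), c, (fun _ => X). split; [constructor|].
  intros g. cbn. now rewrite H.
Qed.

Lemma Def0_False (X0 : sets M) n : Def0 n (fun _ => False).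
Proof. exists FBot, (fun _ => nzero M), (fun _ => X0). split; [constructor|tauto]. Qed.

Lemma Def0_merge n phi psi : Def0 n phi -> Def0 n psi ->
  exists c sig A B, Sigma00 A /\ Sigma00 B /\ forall g,
    (sat M (env n c g) sig A <-> phi g) /\ (sat M (env n c g) sig B <-> psi g).
Proof.
  intros [A [c [sig [HA E]]]] [B [c' [sig' [HB E']]]].
  destruct (env_merge n c c') as [c0 [s [s' Es]]].
  destruct (sig_merge sig sig') as [sig0 [r [r' [Er Er']]]].
  exists c0, sig0, (fsubst s r A), (fsubst s' r' B).
  split; [now apply Sigma00_subst|]. split; [now apply Sigma00_subst|].
  intros g. destruct (Es g) as [Es1 Es2].
  rewrite !sat_subst, Es1, Es2, Er, Er'. auto.
Qed.

Lemma Def0_imp n phi psi : Def0 n phi -> Def0 n psi -> Def0 n (fun g => phi g -> psi g).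
Proof.
  intros H H'. destruct (Def0_merge n phi psi H H') as [c [sig [A [B [HA [HB E]]]]]].
  exists (FImp A B), c, sig. split; [now constructor|].
  intros g. cbn. destruct (E g) as [-> ->]. tauto.
Qed.

Lemma Def0_and n phi psi : Def0 n phi -> Def0 n psi -> Def0 n (fun g => phi g /\ psi g).
Proof.
  intros H H'. destruct (Def0_merge n phi psi H H') as [c [sig [A [B [HA [HB E]]]]]].
  exists (FAnd A B), c, sig. split; [now constructor|].
  intros g. cbn. destruct (E g) as [-> ->]. tauto.
Qed.

Lemma Def0_or n phi psi : Def0 n phi -> Def0 n psi -> Def0 n (fun g => phi g \/ psi g).
Proof.
  intros H H'. destruct (Def0_merge n phi psi H H') as [c [sig [A [B [HA [HB E]]]]]].
  exists (FOr A B), c, sig. split; [now constructor|].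
  intros g. cbn. destruct (E g) as [-> ->]. tauto.
Qed.

Lemma Def0_not (X0 : sets M) n phi : Def0 n phi -> Def0 n (fun g => ~ phi g).
Proof. intros H. apply Def0_imp; auto using Def0_False. Qed.

Lemma Def0_iff n phi psi : Def0 n phi -> Def0 n psi -> Def0 n (fun g => phi g <-> psi g).
Proof. intros H H'. apply Def0_and; now apply Def0_imp. Qed.

Lemma Def0_quant n f (phi : tup n -> N -> Prop) :
  DefT n f -> Def0 (S n) (fun g => phi (fst g) (snd g)) ->
  exists c sig t A, Sigma00 A /\ forall g,
    teval M (env n c g) t = f g /\
    forall x, sat M (scons x (env n c g)) sig A <-> phi g x.
Proof.
  intros [t [c H]] [A [c' [sig [HA E]]]].
  destruct (env_merge n c c') as [c0 [s [s' Es]]].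
  exists c0, sig, (tsubst s t), (fsubst (up1 s') (fun X => X) A).
  split; [now apply Sigma00_subst|]. intros g. destruct (Es g) as [Es1 Es2]. split.
  - now rewrite teval_subst, Es1.
  - intros x. rewrite sat_subst, scons_up1, Es2. apply (E (g, x)).
Qed.

Lemma Def0_ball n f (phi : tup n -> N -> Prop) :
  DefT n f -> Def0 (S n) (fun g => phi (fst g) (snd g)) ->
  Def0 n (fun g => forall x, nlt M x (f g) -> phi g x).
Proof.
  intros H H'. destruct (Def0_quant n f phi H H') as [c [sig [t [A [HA E]]]]].
  exists (FAll1 (FImp (FLt (TVar 0) (tshift t)) A)), c, sig. split; [now constructor|].
  intros g. destruct (E g) as [E1 E2]. cbn. unfold tshift. rewrite <- E1.
  split; intros HH x; specialize (HH x); rewrite teval_subst, E2 in *; exact HH.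
Qed.

Lemma Def0_bex n f (phi : tup n -> N -> Prop) :
  DefT n f -> Def0 (S n) (fun g => phi (fst g) (snd g)) ->
  Def0 n (fun g => exists x, nlt M x (f g) /\ phi g x).
Proof.
  intros H H'. destruct (Def0_quant n f phi H H') as [c [sig [t [A [HA E]]]]].
  exists (FEx1 (FAnd (FLt (TVar 0) (tshift t)) A)), c, sig. split; [now constructor|].
  intros g. destruct (E g) as [E1 E2]. cbn. unfold tshift. rewrite <- E1.
  split; intros [x HH]; exists x; rewrite teval_subst, E2 in *; exact HH.
Qed.

(** A quantifier counts as bounded when its body holds automatically beyond a term; this lets the
    coding notions keep the shape they have as formulas. *)
Lemma Def0_all n (f : tup n -> N) (phi : tup n -> N -> Prop) :
  DefT n f -> Def0 (S n) (fun g => phi (fst g) (snd g)) ->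
  (forall g x, ~ nlt M x (f g) -> phi g x) ->
  Def0 n (fun g => forall x, phi g x).
Proof.
  intros H H' HB. eapply Def0_ext; [|apply Def0_ball; [exact H|exact H']].
  intros g. split; intros HH x; [|auto].
  destruct (classic (nlt M x (f g))); auto.
Qed.

Lemma Def0_ex n (f : tup n -> N) (phi : tup n -> N -> Prop) :
  DefT n f -> Def0 (S n) (fun g => phi (fst g) (snd g)) ->
  (forall g x, phi g x -> nlt M x (f g)) ->
  Def0 n (fun g => exists x, phi g x).
Proof.
  intros H H' HB. eapply Def0_ext; [|apply Def0_bex; [exact H|exact H']].
  intros g. split; intros [x HH]; exists x; [tauto|auto].
Qed.

Lemma Def0_reindex n m phi (h : tup m -> tup n) s :
  (forall c g k, teval M (env m c g) (s k) = env n c (h g) k) ->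
  Def0 n phi -> Def0 m (fun g => phi (h g)).
Proof.
  intros Hs [A [c [sig [HA E]]]]. exists (fsubst s (fun X => X) A), c, sig.
  split; [now apply Sigma00_subst|]. intros g.
  rewrite sat_subst, <- E.
  replace (fun k => teval M (env m c g) (s k)) with (env n c (h g)); [reflexivity|].
  apply functional_extensionality; intros k. now rewrite Hs.
Qed.

Lemma Def1_Def0 n phi : Def0 n phi -> Def1 n phi.
Proof.
  intros H. exists (fun g => phi (fst g)). split.
  { now apply (Def0_reindex n (S n) phi fst (fun k => TVar (S k))). }
  intros g. cbn. split; [intros; now exists (nzero M)|intros [_ ?]; auto].
Qed.

Lemma Def1_ex0 n (phi : tup n -> N -> Prop) :
  Def0 (S n) (fun g => phi (fst g) (snd g)) -> Def1 n (fun g => exists x, phi g x).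
Proof. intros H. eexists. split; [exact H|]. intros g. reflexivity. Qed.

End Definability.

Ltac defn_var :=
  first [ apply DefT_v0 | apply DefT_v1 | apply DefT_v2 | apply DefT_v3 | apply DefT_v4 ].

(** * Arithmetic in a model of RCA_0 *)

Declare Scope m_scope.
Delimit Scope m_scope with m.

Section Arithmetic.
Variable M : structure.
Hypothesis HM : models M RCA0.
(** Satisfaction needs a value for every set variable, even in a formula without any; [X0] fills
    these places. *)
Variable X0 : sets M.

Notation N := (num M).
Local Notation "0" := (nzero M) : m_scope.
Local Notation "1" := (none M) : m_scope.
Local Notation "a + b" := (nadd M a b) : m_scope.
Local Notation "a * b" := (nmul M a b) : m_scope.
Local Notation "a < b" := (nlt M a b) : m_scope.
Local Notation "x 'el' X" := (mem M x X) (at level 70) : m_scope.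
Local Open Scope m_scope.

(** A hook, redefined as further notions are shown to be definable, through which [defn] treats them
    as atomic. *)
Ltac defn_macro := fail.

Ltac defn_step :=
  match goal with
  (* Closure lemmas posed in the context are tried first, so that the notion they concern is not
     taken apart. *)
  | H : forall n, _ |- _ => apply H
  | H : DefT _ _ _ |- DefT _ _ _ =>
    first [ exact H | exact (DefT_fst _ _ _ H) | exact (DefT_fst _ _ _ (DefT_fst _ _ _ H))
          | exact (DefT_fst _ _ _ (DefT_fst _ _ _ (DefT_fst _ _ _ H))) ]
  | |- DefT _ _ _ => first [ defn_var | apply DefT_add | apply DefT_mul | apply DefT_const ]
  | |- Def0 _ _ _ =>
    first [ defn_macro | assumption
          | apply Def0_mem | apply (Def0_eq M X0) | apply (Def0_lt M X0)
          | apply (Def0_False M X0) | apply (Def0_not M X0)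
          | apply Def0_iff | apply Def0_and | apply Def0_or
          | apply Def0_ball | apply Def0_bex | apply Def0_imp ]
  end.

Ltac defn := repeat defn_step.

Lemma ind1 (phi : N -> Prop) : Def1 M (S O) (fun g => phi (snd g)) ->
  phi 0 -> (forall x, phi x -> phi (x + 1)) -> forall x, phi x.
Proof.
  intros [psi [[A [c [sig [HA E]]]] Epsi]] H0 HS.
  assert (Hsat : forall x, sat M (scons x c) sig (FEx1 A) <-> phi x).
  { intros x. cbn. rewrite (Epsi (tt, x)). split; intros [y Hy]; exists y.
    - now apply (E (tt, x, y)).
    - now apply (E (tt, x, y)) in Hy. }
  intros x. apply Hsat.
  refine (HM _ (RCA0_induction (FEx1 A) (Sigma01_ex A HA)) c sig _ x).
  split.
  - apply sat_subst.
    replace (fun k => _) with (scons 0 c); [now apply Hsat|].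
    apply functional_extensionality; intros [|k]; reflexivity.
  - intros y Hy. apply sat_subst.
    replace (fun k => _) with (scons (y + 1) c); [now apply Hsat, HS, Hsat|].
    apply functional_extensionality; intros [|k]; reflexivity.
Qed.

Lemma ind0 (phi : N -> Prop) : Def0 M (S O) (fun g => phi (snd g)) ->
  phi 0 -> (forall x, phi x -> phi (x + 1)) -> forall x, phi x.
Proof. intros H. apply ind1. now apply Def1_Def0. Qed.

Ltac by_ind0 := match goal with |- forall x, @?P x => apply (ind0 P) end.
Ltac by_ind1 := match goal with |- forall x, @?P x => apply (ind1 P) end.

Lemma comprehension (phi : N -> Prop) : Def0 M (S O) (fun g => phi (snd g)) ->
  exists X, forall x, x el X <-> phi x.
Proof.
  intros [A [c [sig [HA E]]]].
  (* Behind a dummy quantifier the same bounded formula serves as the Sigma^0_1 and as the Pi^0_1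
     definition. *)
  assert (HA' : Sigma00 (shift1 A)) by now apply Sigma00_subst.
  destruct (HM _ (RCA0_comprehension _ _ (Sigma01_ex _ HA') (Pi01_all _ HA')) c sig)
    as [X HX].
  - intros x. cbn. unfold shift1. split.
    + intros [z H] y. rewrite sat_subst in *. exact H.
    + intros H. exists 0. apply H.
  - exists X. intros x. change (x el X) with (sat M (scons x c) (scons X sig) (FMem (TVar O) O)).
    rewrite <- (E (tt, x)). destruct (HX x) as [H1 H2]. split.
    + intros H. apply H1 in H. unfold shift2 in H. rewrite sat_subst in H.
      destruct H as [y H]. unfold shift1 in H. rewrite sat_subst in H. exact H.
    + intros H. apply H2. unfold shift2. rewrite sat_subst. exists 0.
      unfold shift1. rewrite sat_subst. exact H.
Qed.

Let rho0 (k : nat) := 0.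
Let sig0 (k : nat) := X0.

Lemma succ_neq0 a : a + 1 <> 0.
Proof. exact (HM _ RCA0_succ_neq0 rho0 sig0 a). Qed.
Lemma succ_inj a b : a + 1 = b + 1 -> a = b.
Proof. exact (HM _ RCA0_succ_inj rho0 sig0 a b). Qed.
Lemma add_0_r a : a + 0 = a.
Proof. exact (HM _ RCA0_add0 rho0 sig0 a). Qed.
Lemma add_succ_r a b : a + (b + 1) = (a + b) + 1.
Proof. exact (HM _ RCA0_addS rho0 sig0 a b). Qed.
Lemma mul_0_r a : a * 0 = 0.
Proof. exact (HM _ RCA0_mul0 rho0 sig0 a). Qed.
Lemma mul_succ_r a b : a * (b + 1) = a * b + a.
Proof. exact (HM _ RCA0_mulS rho0 sig0 a b). Qed.
Lemma nlt_0_r a : ~ a < 0.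
Proof. exact (HM _ RCA0_nlt0 rho0 sig0 a). Qed.
Lemma lt_succ_r a b : a < b + 1 <-> a < b \/ a = b.
Proof. exact (HM _ RCA0_ltS rho0 sig0 a b). Qed.

Lemma add_assoc a b c : a + (b + c) = (a + b) + c.
Proof.
  revert c. by_ind0; [defn|now rewrite !add_0_r|].
  intros c IH. now rewrite !add_succ_r, IH.
Qed.

Lemma add_0_l a : 0 + a = a.
Proof.
  revert a. by_ind0; [defn|apply add_0_r|]. intros a IH. now rewrite add_succ_r, IH.
Qed.

Lemma add_succ_l a b : (a + 1) + b = (a + b) + 1.
Proof.
  revert b. by_ind0; [defn|now rewrite !add_0_r|].
  intros b IH. now rewrite !add_succ_r, IH.
Qed.

Lemma add_comm a b : a + b = b + a.
Proof.
  revert b. by_ind0; [defn|now rewrite add_0_r, add_0_l|].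
  intros b IH. now rewrite add_succ_r, add_succ_l, IH.
Qed.

Lemma mul_0_l a : 0 * a = 0.
Proof.
  revert a. by_ind0; [defn|apply mul_0_r|].
  intros a IH. now rewrite mul_succ_r, IH, add_0_r.
Qed.

Lemma mul_succ_l a b : (a + 1) * b = a * b + b.
Proof.
  revert b. by_ind0; [defn|now rewrite !mul_0_r, add_0_r|].
  intros b IH. rewrite !mul_succ_r, IH, !add_succ_r. f_equal.
  rewrite <- !add_assoc. f_equal. apply add_comm.
Qed.

Lemma mul_comm a b : a * b = b * a.
Proof.
  revert b. by_ind0; [defn|now rewrite mul_0_r, mul_0_l|].
  intros b IH. now rewrite mul_succ_r, mul_succ_l, IH.
Qed.

Lemma mul_1_l a : 1 * a = a.
Proof. now rewrite <- (add_0_l 1), mul_succ_l, mul_0_l, add_0_l. Qed.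

Lemma mul_add_distr_r a b c : (a + b) * c = a * c + b * c.
Proof.
  revert c. by_ind0; [defn|now rewrite !mul_0_r, add_0_r|].
  intros c IH. rewrite !mul_succ_r, IH, <- !add_assoc. f_equal.
  rewrite !add_assoc. f_equal. apply add_comm.
Qed.

Lemma mul_assoc a b c : a * (b * c) = (a * b) * c.
Proof.
  revert c. by_ind0; [defn|now rewrite !mul_0_r|].
  intros c IH. rewrite !mul_succ_r, <- IH, (mul_comm a), mul_add_distr_r.
  now rewrite (mul_comm _ a), (mul_comm b a).
Qed.

Lemma semiring : semi_ring_theory 0 1 (nadd M) (nmul M) eq.
Proof.
  constructor.
  - apply add_0_l.
  - apply add_comm.
  - apply add_assoc.
  - apply mul_1_l.
  - apply mul_0_l.
  - apply mul_comm.
  - apply mul_assoc.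
  - apply mul_add_distr_r.
Qed.

Add Ring num_ring : semiring.

(** * Cancellation, order and the least number principle *)

Lemma add_cancel_r a b c : a + c = b + c -> a = b.
Proof.
  revert c. by_ind0; [defn|now rewrite !add_0_r|].
  intros c IH. rewrite !add_succ_r. intros H. now apply IH, succ_inj.
Qed.

Lemma add_cancel_l a b c : c + a = c + b -> a = b.
Proof. rewrite !(add_comm c). apply add_cancel_r. Qed.

Lemma lt_iff a b : a < b <-> exists c, b = a + c + 1.
Proof.
  split.
  (* The witness is quantified outside the implication to keep the induction formula Sigma^0_1. *)
  - assert (H : forall b, exists c, a < b -> b = a + c + 1).
    { by_ind1; [apply Def1_ex0; defn|exists 0; intros H; now apply nlt_0_r in H|].
      intros x [c IH]. destruct (classic (a < x)) as [H|H].
      - exists (c + 1). intros _. rewrite (IH H). ring.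
      - exists 0. intros H'. apply lt_succ_r in H' as [|<-]; [tauto|]. ring. }
    intros Hab. destruct (H b) as [c Hc]. exists c. auto.
  - intros [c ->]. revert c. by_ind0; [defn| |].
    + apply lt_succ_r. right. ring.
    + intros c IH. apply lt_succ_r. left.
      replace (a + (c + 1)) with (a + c + 1) by ring. exact IH.
Qed.

Lemma zero_or_succ a : a = 0 \/ exists c, a = c + 1.
Proof.
  assert (H : forall a, a = 0 \/ 0 < a).
  { by_ind0; [defn|now left|]. intros b [->|H]; right; apply lt_succ_r; auto. }
  destruct (H a) as [->|Ha]; [now left|]. right.
  apply lt_iff in Ha as [c ->]. exists c. ring.
Qed.

Lemma add_eq_0 a b : a + b = 0 -> a = 0.
Proof.
  destruct (zero_or_succ a) as [|[c ->]]; auto.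
  replace (c + 1 + b) with (c + b + 1) by ring. intros H. now apply succ_neq0 in H.
Qed.

Lemma add_succ_neq a c : a <> a + c + 1.
Proof.
  intros H. apply (succ_neq0 c), (add_cancel_l _ _ a). rewrite add_0_r.
  symmetry. rewrite H at 1. ring.
Qed.

Lemma lt_irrefl a : ~ a < a.
Proof. intros H. apply lt_iff in H as [c H]. now apply add_succ_neq in H. Qed.

Lemma lt_trans a b c : a < b -> b < c -> a < c.
Proof.
  rewrite !lt_iff. intros [x ->] [y ->]. exists (x + y + 1). ring.
Qed.

Lemma lt_trichotomy a b : a < b \/ a = b \/ b < a.
Proof.
  revert a. by_ind0; [defn| |].
  - destruct (zero_or_succ b) as [|[c ->]]; [auto|]. left. apply lt_iff. exists c. ring.
  - intros a [H|[->|H]].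
    + apply lt_iff in H as [c ->]. destruct (zero_or_succ c) as [->|[d ->]].
      * right; left. ring.
      * left. apply lt_iff. exists d. ring.
    + right; right. apply lt_succ_r. now right.
    + right; right. apply lt_succ_r. now left.
Qed.

(** [a < b + 1] stands for a at most b, for which the language has no symbol. *)
Lemma lt_succ_iff a b : a < b + 1 <-> exists c, b = a + c.
Proof.
  rewrite lt_iff. split; intros [c H]; exists c.
  - now apply succ_inj.
  - now rewrite H.
Qed.

Lemma lt_le_trans a b c : a < b -> b < c + 1 -> a < c.
Proof.
  rewrite lt_succ_iff, !lt_iff. intros [x ->] [y ->]. exists (x + y). ring.
Qed.

Lemma le_lt_trans a b c : a < b + 1 -> b < c -> a < c.
Proof.
  rewrite lt_succ_iff, !lt_iff. intros [x ->] [y ->]. exists (x + y). ring.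
Qed.

Lemma not_lt a b : ~ a < b -> b < a + 1.
Proof.
  rewrite lt_succ_r. destruct (lt_trichotomy a b) as [|[->|]]; tauto.
Qed.

Lemma lt_succ_diag a : a < a + 1.
Proof. apply lt_succ_r. now right. Qed.

Lemma lt_add_r a b : a < a + b + 1.
Proof. apply lt_iff. now exists b. Qed.

Lemma mul_neq_0 a b : a <> 0 -> b <> 0 -> a * b <> 0.
Proof.
  intros Ha Hb. destruct (zero_or_succ a) as [|[c ->]]; [tauto|].
  destruct (zero_or_succ b) as [|[d ->]]; [tauto|].
  replace ((c + 1) * (d + 1)) with ((c * d + c + d) + 1) by ring. apply succ_neq0.
Qed.

Lemma one_neq_0 : 1 <> 0.
Proof. rewrite <- (add_0_l 1). apply succ_neq0. Qed.

(** Two unbounded witnesses contract to one: a common strict bound, [x + y + 1], below which both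
    are sought. *)
Lemma Def1_ex n (phi : tup M n -> N -> Prop) :
  Def1 M (S n) (fun g => phi (fst g) (snd g)) -> Def1 M n (fun g => exists x, phi g x).
Proof.
  intros [psi [H E]].
  exists (fun h => exists x, x < snd h /\ exists y, y < snd h /\ psi (fst h, x, y)). split.
  - defn.
    apply (Def0_reindex M (S (S n)) (S (S (S n))) psi
      (fun h => (fst (fst (fst h)), snd (fst h), snd h))
      (scons (TVar O) (scons (TVar (S O)) (fun k => TVar (S (S (S k))))))); [|exact H].
    intros c g [|[|k]]; reflexivity.
  - intros g. split.
    + intros [x Hx]. apply (E (g, x)) in Hx as [y Hy]. exists (x + y + 1).
      exists x. split; [apply lt_add_r|]. exists y.
      split; [rewrite (add_comm x y); apply lt_add_r|exact Hy].
    + intros [b [x [_ [y [_ H']]]]]. exists x. apply (E (g, x)). now exists y.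
Qed.

Lemma least_number (phi : N -> Prop) a : Def0 M (S O) (fun g => phi (snd g)) -> phi a ->
  exists b, phi b /\ forall y, y < b -> ~ phi y.
Proof.
  intros Hphi Ha. apply NNPP. intros HN.
  (* Without a least element one could descend from [a] any number [u] of times, reaching an element
     at most a - u; this is absurd for u = a + 1. *)
  assert (H : forall u, exists y, phi y /\ y + u < a + 1).
  { by_ind1.
    - apply Def1_ex0. defn.
      apply (Def0_reindex M (S O) (S (S O)) (fun g => phi (snd g)) (fun h => (tt, snd h))
        (scons (TVar O) (fun k => TVar (S (S k))))); [|exact Hphi].
      intros c g [|k]; reflexivity.
    - exists a. rewrite add_0_r. auto using lt_succ_diag.
    - intros u [y [Hy Hu]]. apply NNPP. intros HN'. apply HN. exists y. split; [auto|].
      intros z Hz Hphiz. apply HN'. exists z. split; [auto|].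
      apply le_lt_trans with (y + u); auto. apply lt_succ_iff.
      apply lt_iff in Hz as [c ->]. exists c. ring. }
  destruct (H (a + 1)) as [y [_ Hy]]. apply lt_iff in Hy as [c Hc].
  apply (add_succ_neq (a + 1) (y + c)). rewrite Hc at 1. ring.
Qed.

(** * Divisibility and strong bounding *)

Definition dvd (a b : N) : Prop := exists q, b = q * a.

(** The quotient is v - u when this makes sense; if v < u, the equation forces x = 0. *)
Lemma dvd_sub p x u v : x + u * p = v * p -> dvd p x.
Proof.
  intros H. destruct (classic (v < u)) as [Hv|Hv].
  - apply lt_iff in Hv as [c ->]. exists 0. rewrite mul_0_l.
    apply add_eq_0 with ((c + 1) * p), (add_cancel_r _ _ (v * p)).
    rewrite add_0_l. etransitivity; [|exact H]. ring.
  - apply not_lt, lt_succ_iff in Hv as [c ->]. exists c.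
    apply (add_cancel_r _ _ (u * p)). rewrite H. ring.
Qed.

(* Modulo [p = m a + 1] we have [m a = -1], so [n] is congruent to [n (m a)^2], a multiple
   of [n m d] since [d] divides [m]. *)
Lemma dvd_cancel m a d n : dvd d m -> dvd (m * a + 1) (n * m * d) -> dvd (m * a + 1) n.
Proof.
  intros [e He] [t Ht].
  apply dvd_sub with (n * (m * a + 1)) (t * e * a * a + n + n).
  assert (E : n * m * m * (a * a) = t * (m * a + 1) * e * (a * a)).
  { rewrite He at 2. rewrite <- Ht. ring. }
  transitivity (n * m * m * (a * a) + (n + n) * (m * a + 1)); [ring|].
  rewrite E. ring.
Qed.

(** The moduli of Goedel's beta function, as they occur in [fin_elem]. *)
Definition modulus (m i : N) : N := m * (i + 1) + 1.

(** The two moduli differ by m times the distance of i and j, and this distance divides m. Hence n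
    times m times the distance is divisible by the first modulus, and [dvd_cancel] applies. *)
Lemma modulus_coprime m k i j n : (forall d, d < k -> dvd (d + 1) m) ->
  i < k -> j < k -> i <> j -> dvd (modulus m i) (n * modulus m j) -> dvd (modulus m i) n.
Proof.
  intros Hm Hi Hj Hij [q Hq]. unfold modulus in *.
  destruct (lt_trichotomy i j) as [H|[H|H]]; [|tauto|]; apply lt_iff in H as [c ->].
  - apply dvd_cancel with (c + 1).
    { apply Hm. apply le_lt_trans with (i + c + 1); auto. apply lt_succ_iff. exists (i + 1). ring. }
    apply dvd_sub with n q. rewrite <- Hq. ring.
  - apply dvd_cancel with (c + 1).
    { apply Hm. apply le_lt_trans with (j + c + 1); auto. apply lt_succ_iff. exists (j + 1). ring. }
    apply dvd_sub with q n. rewrite <- Hq. ring.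
Qed.

Lemma modulus_neq_0 m i : modulus m i <> 0.
Proof. apply succ_neq0. Qed.

Lemma le_mul_succ a b : a < a * (b + 1) + 1.
Proof. apply lt_succ_iff. exists (a * b). ring. Qed.

Lemma Def0_dvd n f h : DefT M n f -> DefT M n h -> Def0 M n (fun g => dvd (f g) (h g)).
Proof.
  intros Hf Hh.
  apply Def0_ext with (fun g => (f g = 0 /\ h g = 0) \/
    (f g <> 0 /\ exists q, q < h g + 1 /\ h g = q * f g)).
  - intros g. split.
    + intros [[H1 H2]|[_ [q [_ H]]]]; [|now exists q].
      exists 0. rewrite H2, mul_0_l. reflexivity.
    + intros [q Hq]. destruct (zero_or_succ (f g)) as [H|[c H]].
      * left. split; auto. rewrite Hq, H. apply mul_0_r.
      * right. rewrite H in *. split; [apply succ_neq0|]. exists q. split; auto.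
        rewrite Hq. apply le_mul_succ.
  - defn.
Qed.

Ltac defn_macro ::= apply Def0_dvd.

(** With no term for an iterated product, the product of the [f i] is built by Sigma^0_1 induction
    on [k]. *)
Lemma common_multiple (f : N -> N) k :
  (forall n t, DefT M n t -> DefT M n (fun g => f (t g))) ->
  (forall i, f i <> 0) ->
  exists m, m <> 0 /\ forall i, i < k -> dvd (f i) m.
Proof.
  intros Hf Hf0. revert k. by_ind1.
  - apply Def1_ex0. defn.
  - exists 1. split; [apply one_neq_0|]. intros i Hi. now apply nlt_0_r in Hi.
  - intros k [m [Hm H]]. exists (m * f k). split; [now apply mul_neq_0|].
    intros i Hi. apply lt_succ_r in Hi as [Hi| ->]; [|now exists m].
    destruct (H i Hi) as [q Hq]. exists (q * f k). rewrite Hq. ring.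
Qed.

(** Plays the part of the factorial of k in the beta function. *)
Lemma moduli_base k : exists m, m <> 0 /\ forall d, d < k -> dvd (d + 1) m.
Proof. apply (common_multiple (fun d => d + 1)); [intros; defn|apply succ_neq0]. Qed.

(* Let [n] be the least nonzero number such that, for some [b], [modulus m i] divides [n]
   for every [i < k] without a witness below [b]. Then no such [i] has a witness at all,
   because its modulus could be cancelled from [n]. *)
Lemma strong_bounding (theta : N -> N -> Prop) k :
  (forall n t u, DefT M n t -> DefT M n u -> Def0 M n (fun g => theta (t g) (u g))) ->
  exists b, forall i, i < k -> (exists x, theta i x) -> exists x, x < b /\ theta i x.
Proof.
  intros Htheta. apply NNPP. intros HN.
  destruct (moduli_base k) as [m [Hm0 Hm]].
  destruct (common_multiple (modulus m) k) as [n0 [Hn0 Hdiv]];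
    [intros; unfold modulus; defn|apply modulus_neq_0|].
  (* Minimality in the form of a descent: [u] counts the cancellations, each of which lowers [n] by
     at least one. *)
  assert (H : forall u, exists n b, n <> 0 /\ n + u < n0 + 1 /\
    forall i, i < k -> (exists x, x < b /\ theta i x) \/ dvd (modulus m i) n).
  { by_ind1.
    - apply Def1_ex, Def1_ex0. unfold modulus. defn.
    - exists n0, 0. rewrite add_0_r. auto using lt_succ_diag.
    - intros u [n [b [Hn [Hu H]]]].
      assert (HE : exists i x, i < k /\ theta i x /\ ~ exists x, x < b /\ theta i x).
      { apply NNPP. intros HN'. apply HN. exists b. intros i Hi [x Hx].
        apply NNPP. intros HN''. apply HN'. now exists i, x. }
      destruct HE as [i [x [Hi [Hx Hib]]]].
      destruct (H i Hi) as [|[q Hq]]; [tauto|].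
      assert (Hq0 : q <> 0). { intros ->. apply Hn. rewrite Hq. apply mul_0_l. }
      (* The modulus of [i] is cancelled from [n], and the bound is raised past the witness [x] of
         [i]. *)
      exists q, (b + x + 1). split; [auto|]. split.
      + destruct (zero_or_succ (q * m * (i + 1))) as [HH|[c Hc]].
        { exfalso. revert HH. apply mul_neq_0; [now apply mul_neq_0|apply succ_neq0]. }
        apply le_lt_trans with (n + u); [|auto]. apply lt_succ_iff. exists c.
        transitivity (q + u + (c + 1)); [|ring]. rewrite <- Hc, Hq. unfold modulus. ring.
      + intros j Hj. destruct (H j Hj) as [[y [Hy Hjy]]|HD].
        * left. exists y. split; auto. apply lt_trans with b; auto. apply lt_add_r.
        * destruct (classic (j = i)) as [->|Hji].
          -- left. exists x. split; auto. rewrite (add_comm b x). apply lt_add_r.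
          -- right. rewrite Hq in HD. exact (modulus_coprime m k j i q Hm Hj Hi Hji HD). }
  destruct (H (n0 + 1)) as [n [b [_ [Hn _]]]]. apply lt_iff in Hn as [c Hc].
  apply (add_succ_neq (n0 + 1) (n + c)). rewrite Hc at 1. ring.
Qed.

(** * Coding of finite sets *)

Definition pair (i j : N) : N := (i + j) * (i + j) + i.

Lemma DefT_pair n f h : DefT M n f -> DefT M n h -> DefT M n (fun g => pair (f g) (h g)).
Proof. intros. unfold pair. defn. Qed.

Lemma pair_ge_l i j : i < pair i j + 1.
Proof. apply lt_succ_iff. exists ((i + j) * (i + j)). unfold pair. ring. Qed.

Lemma pair_ge_r i j : j < pair i j + 1.
Proof.
  apply lt_succ_iff. unfold pair. destruct (zero_or_succ j) as [->|[c ->]].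
  - exists ((i + 0) * (i + 0) + i). ring.
  - exists ((i + c + 1) * (i + c) + i + i). ring.
Qed.

(** i + j is the integer square root of [pair i j], hence determined by it. *)
Lemma pair_sum_le i j i' j' : pair i j = pair i' j' -> ~ i + j < i' + j'.
Proof.
  unfold pair. intros H Hlt. apply lt_iff in Hlt as [c Hc]. rewrite Hc in H.
  (* The second argument is one less than the excess of (i + j + c + 1)^2 + i' over (i + j)^2 +
     i. *)
  apply (add_succ_neq ((i + j) * (i + j) + i) (i + j + j + (c + c) * (i + j) + c * c + c + c + i')).
  rewrite H at 1. ring.
Qed.

Lemma pair_inj i j i' j' : pair i j = pair i' j' -> i = i' /\ j = j'.
Proof.
  intros H.
  assert (E : i + j = i' + j').
  { destruct (lt_trichotomy (i + j) (i' + j')) as [HH|[HH|HH]]; auto.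
    - now apply pair_sum_le in HH.
    - now apply pair_sum_le in HH. }
  unfold pair in H. rewrite E in H. apply add_cancel_l in H. subst i'.
  now apply add_cancel_l in E.
Qed.

(** This and the coding notions below spell out the satisfaction clauses of the corresponding
    formulas, so that both agree up to conversion. *)
Definition felem (i s : N) : Prop :=
  exists k m n, s = pair k (pair m n) /\ i < k /\ dvd (modulus m i) n.

Definition frepr (s : N) : Prop := exists k m n, s = pair k (pair m n).

Definition fcode (s : N) : Prop :=
  frepr s /\ forall s', s' < s /\ frepr s' -> ~ forall i, felem i s' <-> felem i s.

Lemma felem_lt i s : felem i s -> i < s.
Proof. intros [k [m [n [-> [Hi _]]]]]. eapply lt_le_trans; eauto. apply pair_ge_l. Qed.

Lemma felem_pair_l i j s : felem (pair i j) s -> i < s.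
Proof. intros H. eapply le_lt_trans; [apply pair_ge_l|]. apply felem_lt, H. Qed.

Lemma felem_pair_r i j s : felem (pair i j) s -> j < s.
Proof. intros H. eapply le_lt_trans; [apply pair_ge_r|]. apply felem_lt, H. Qed.

Lemma le_trans a b c : a < b + 1 -> b < c + 1 -> a < c + 1.
Proof. intros. eapply le_lt_trans; eauto. Qed.

Lemma Def0_frepr n f : DefT M n f -> Def0 M n (fun g => frepr (f g)).
Proof.
  intros Hf.
  apply Def0_ext with (fun g => exists k, k < f g + 1 /\ exists m, m < f g + 1 /\
    exists l, l < f g + 1 /\ f g = pair k (pair m l)).
  - intros g. split.
    + intros [k [_ [m [_ [l [_ H]]]]]]. now exists k, m, l.
    + intros [k [m [l H]]]. exists k. split; [rewrite H; apply pair_ge_l|].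
      exists m. split; [rewrite H; eapply le_trans; [apply pair_ge_l|apply pair_ge_r]|].
      exists l. split; [rewrite H; eapply le_trans; [apply pair_ge_r|apply pair_ge_r]|auto].
  - unfold pair. defn.
Qed.

Lemma Def0_felem n f h : DefT M n f -> DefT M n h -> Def0 M n (fun g => felem (f g) (h g)).
Proof.
  intros Hf Hh.
  apply Def0_ext with (fun g => exists k, k < h g + 1 /\ exists m, m < h g + 1 /\
    exists l, l < h g + 1 /\ h g = pair k (pair m l) /\ f g < k /\ dvd (modulus m (f g)) l).
  - intros g. split.
    + intros [k [_ [m [_ [l [_ H]]]]]]. now exists k, m, l.
    + intros [k [m [l [H H']]]]. exists k. split; [rewrite H; apply pair_ge_l|].
      exists m. split; [rewrite H; eapply le_trans; [apply pair_ge_l|apply pair_ge_r]|].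
      exists l. split; [rewrite H; eapply le_trans; [apply pair_ge_r|apply pair_ge_r]|auto].
  - unfold pair, modulus. defn.
Qed.

Lemma Def0_fcode n f : DefT M n f -> Def0 M n (fun g => fcode (f g)).
Proof.
  intros Hf.
  apply Def0_ext with (fun g => frepr (f g) /\ forall s', s' < f g ->
    frepr s' -> ~ forall i, i < f g -> felem i s' <-> felem i (f g)).
  - intros g. split; intros [H1 H2]; split; auto.
    + intros s' [Hs' Hr] H. apply (H2 s'); auto.
    + intros s' Hs' Hr H. apply (H2 s'); auto. intros i. split; intros Hi; apply H; auto.
      * apply lt_trans with s'; auto using felem_lt.
      * now apply felem_lt.
  - pose proof Def0_felem. pose proof Def0_frepr. defn.
Qed.

Ltac defn_macro ::=
  first [ apply Def0_dvd | apply Def0_frepr | apply Def0_felem | apply Def0_fcode ].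

Lemma felem_repr k m n i : felem i (pair k (pair m n)) <-> i < k /\ dvd (modulus m i) n.
Proof.
  split; [|intros H; now exists k, m, n].
  intros [k' [m' [n' [E H]]]]. apply pair_inj in E as [-> E]. now apply pair_inj in E as [-> ->].
Qed.

(** [n] is the product of the moduli of the elements of [X] below [k]; coprimality keeps the moduli
    of other indices from dividing it. *)
Lemma finite_repr X k : exists s, frepr s /\ forall i, felem i s <-> i < k /\ i el X.
Proof.
  destruct (moduli_base k) as [m [Hm0 Hm]].
  assert (H : forall j, exists n, forall i, i < k ->
    (dvd (modulus m i) n <-> i < j /\ i el X)).
  { by_ind1.
    - apply Def1_ex0. unfold modulus. defn.
    (* The empty product: as m is nonzero, every modulus exceeds 1 and does not divide it. *)
    - exists 1. intros i _. split; [|intros [H _]; now apply nlt_0_r in H].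
      intros [q Hq]. exfalso. unfold modulus in Hq.
      destruct (zero_or_succ q) as [->|[c ->]].
      + rewrite mul_0_l in Hq. now apply one_neq_0 in Hq.
      + apply (mul_neq_0 m (i + 1)); [auto|apply succ_neq0|].
        apply add_eq_0 with (c * (m * (i + 1) + 1)), (add_cancel_r _ _ 1).
        rewrite add_0_l. etransitivity; [|symmetry; exact Hq]. ring.
    - intros j [n Hn].
      destruct (classic (j < k /\ j el X)) as [[Hj HX]|HX].
      + exists (n * modulus m j). intros i Hi.
        destruct (classic (i = j)) as [->|Hij].
        { split; [intros _; split; [apply lt_succ_diag|auto]|intros _; now exists n]. }
        rewrite lt_succ_r. split.
        * intros H. apply (modulus_coprime m k i j n Hm Hi Hj Hij) in H.
          apply Hn in H; tauto.
        * intros [[H|H] H']; [|tauto]. destruct (proj2 (Hn i Hi) (conj H H')) as [q ->].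
          exists (q * modulus m j). ring.
      + exists n. intros i Hi. rewrite (Hn i Hi), lt_succ_r.
        split; [tauto|]. intros [[H| ->] H']; tauto. }
  destruct (H k) as [n Hn]. exists (pair k (pair m n)). split; [now exists k, m, n|].
  intros i. rewrite felem_repr. split; intros [H1 H2]; split; auto; apply Hn; auto.
Qed.

Lemma finite_coding X k : exists s, fcode s /\ forall i, felem i s <-> i < k /\ i el X.
Proof.
  destruct (finite_repr X k) as [s0 [H0 E0]].
  destruct (least_number (fun s => frepr s /\ forall i, felem i s <-> felem i s0) s0)
    as [s [[Hs E] Hleast]].
  (* Elements are smaller than their code, so an index not below the sum of the two codes belongs to
     neither set. *)
  - defn. apply Def0_all with (fun g => snd g + s0); defn.
    intros g x Hx. split; intros H; destruct Hx; apply felem_lt in H; apply lt_iff in H as [c Hc].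
    + rewrite Hc. apply lt_iff. exists (c + s0). ring.
    + rewrite Hc. apply lt_iff. exists (c + snd g). ring.
  - split; [auto|tauto].
  - exists s. split; [split; auto|].
    + intros s' [Hlt Hr] H. apply (Hleast s' Hlt). split; auto.
      intros i. rewrite H. apply E.
    + intros i. rewrite E. apply E0.
Qed.

(** * Finite sequences *)

Definition seqlen (s l : N) : Prop := forall i, i < l <-> exists j, felem (pair i j) s.

Definition seqcode (s : N) : Prop :=
  fcode s /\
  (forall x, felem x s -> exists i j, x = pair i j) /\
  (forall i j k, felem (pair i j) s /\ felem (pair i k) s -> j = k) /\
  exists l, seqlen s l.

Definition binseq (s : N) : Prop :=
  seqcode s /\ forall i j, felem (pair i j) s -> j = 0 \/ j = 1.

Lemma seqlen_le s l : seqlen s l -> l < s + 1.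
Proof.
  intros H. apply not_lt. intros Hl. apply H in Hl as [j Hj].
  apply felem_pair_l in Hj. now apply lt_irrefl in Hj.
Qed.

(** Indices and entries of a sequence lie below its code, and its length is at most the code; this
    bounds every quantifier. *)
Lemma Def0_binseq : Def0 M (S O) (fun g => binseq (snd g)).
Proof.
  unfold binseq, seqcode, seqlen. defn.
  - apply Def0_all with (fun g => snd g).
    + defn.
    + defn. apply Def0_ex with (fun g => snd g + 1); [defn| |].
      * apply Def0_ex with (fun g => snd (fst g) + 1); [defn|unfold pair; defn|].
        intros g j ->. apply pair_ge_r.
      * intros g i [j ->]. apply pair_ge_l.
    + intros g x Hx H. now apply felem_lt in H.
  - apply Def0_all with (fun g => snd g); [defn| |].
    + apply Def0_all with (fun g => snd (fst g)); [defn| |].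
      * apply Def0_all with (fun g => snd (fst (fst g))); [defn|unfold pair; defn|].
        intros g k Hk [_ H]. now apply felem_pair_r in H.
      * intros g j Hj k [H _]. now apply felem_pair_r in H.
    + intros g i Hi j k [H _]. now apply felem_pair_l in H.
  - apply Def0_ex with (fun g => snd g + 1); [defn| |intros g l; apply seqlen_le].
    (* Once the length is bounded, both sides of the equivalence fail for an index beyond the
       code. *)
    apply Def0_ext with (fun g => snd g < snd (fst g) + 1 /\
      forall i, i < snd (fst g) + 1 -> (i < snd g <-> exists j, felem (pair i j) (snd (fst g)))).
    + intros g. split.
      * intros [Hl H] i. destruct (classic (i < snd (fst g) + 1)) as [Hi|Hi]; [now apply H|].
        split; intros HH; destruct Hi.
        -- eapply lt_trans; eauto.
        -- destruct HH as [j HH]. apply felem_pair_l in HH. apply lt_succ_r. now left.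
      * intros H. split; [now apply seqlen_le|auto].
    + defn. apply Def0_ex with (fun g => snd (fst (fst g))); [defn|unfold pair; defn|].
      intros g j Hj. now apply felem_pair_r in Hj.
  - apply Def0_all with (fun g => snd g); [defn| |].
    + apply Def0_all with (fun g => snd (fst g)); [defn|unfold pair; defn|].
      intros g j Hj H. now apply felem_pair_r in H.
    + intros g i Hi j H. now apply felem_pair_l in H.
Qed.

(** * The separating interval *)

Section Order.
Hypothesis HW : models M WKL0.
Variables P R D : sets M.
Hypothesis R_sub : forall z, z el R -> exists x y, x el P /\ y el P /\ z = pair x y.
Hypothesis R_refl : forall x, x el P -> pair x x el R.
Hypothesis R_antisym : forall x y, pair x y el R /\ pair y x el R -> x = y.
Hypothesis R_trans : forall x y z, pair x y el R /\ pair y z el R -> pair x z el R.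
Hypothesis D_sub : forall x, x el D -> x el P.
Hypothesis D_anti : forall x y, x el D /\ y el D /\ x <> y ->
  ~ (pair x y el R) /\ ~ (pair y x el R).

Lemma R_dom x y : pair x y el R -> x el P.
Proof.
  intros H. destruct (R_sub _ H) as [x' [y' [Hx [_ E]]]]. now apply pair_inj in E as [-> _].
Qed.

Lemma weak_koenig_model T :
  (forall s, s el T -> binseq s) ->
  (forall s t, s el T /\ binseq t /\ (forall x, felem x t -> felem x s) -> t el T) ->
  ~ (exists k, forall i, i el T -> i < k) ->
  exists g,
    ((forall x, x el g -> exists i j, x = pair i j) /\
     (forall i, exists j, pair i j el g) /\
     (forall i j k, pair i j el g /\ pair i k el g -> j = k)) /\
    forall n, exists s,
      (seqcode s /\ seqlen s n /\ forall x, felem x s -> x el g) /\ s el T.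
Proof.
  intros H1 H2 H3.
  exact (HW _ WKL0_weak_koenig rho0 sig0 T (conj (conj H1 H2) H3)).
Qed.

(* [s] is the characteristic function of a set which, as far as its domain can tell,
   is an initial interval containing [D] and no element strictly above one of [D]. *)
Definition approx (s : N) : Prop :=
  (forall x y, pair x y el R -> felem (pair y 1) s -> (exists j, felem (pair x j) s) ->
    felem (pair x 1) s) /\
  (forall x, x el D -> (exists j, felem (pair x j) s) -> felem (pair x 1) s) /\
  (forall d x, d el D -> d <> x -> pair d x el R -> (exists j, felem (pair d j) s) ->
    ~ felem (pair x 1) s) /\
  (forall x, felem (pair x 1) s -> x el P).

Lemma Def0_dom n f h : DefT M n f -> DefT M n h ->
  Def0 M n (fun g => exists j, felem (pair (f g) j) (h g)).
Proof.
  intros Hf Hh. apply Def0_ex with h; [auto|unfold pair; defn|].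
  intros g j H. now apply felem_pair_r in H.
Qed.

Lemma Def0_approx : Def0 M (S O) (fun g => approx (snd g)).
Proof.
  pose proof DefT_pair. pose proof Def0_dom. unfold approx. defn.
  - apply Def0_all with (fun g => snd g); [defn| |].
    + apply Def0_all with (fun g => snd (fst g)); [defn|defn|].
      intros g y Hy _ H'. now apply felem_pair_l in H'.
    + intros g x Hx y _ _ [j H']. now apply felem_pair_l in H'.
  - apply Def0_all with (fun g => snd g); [defn|defn|].
    intros g x Hx _ [j H']. now apply felem_pair_l in H'.
  - apply Def0_all with (fun g => snd g); [defn| |].
    + apply Def0_all with (fun g => snd (fst g)); [defn|defn|].
      intros g x Hx _ _ _ _ H'. now apply felem_pair_l in H'.
    + intros g d Hd x _ _ _ [j H']. now apply felem_pair_l in H'.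
  - apply Def0_all with (fun g => snd g); [defn|defn|].
    intros g x Hx H'. now apply felem_pair_l in H'.
Qed.

Lemma pair_lt_l x x' j : x < x' -> pair x j < pair x' j.
Proof.
  rewrite !lt_iff. intros [c ->].
  exists ((x + j + x + j) * (c + 1) + c * c + c + c + c + 1). unfold pair. ring.
Qed.

(* The characteristic function on [n] of the downward closure of the elements of [D]
   below [n]. *)
Lemma approx_exists n : exists s, binseq s /\ approx s /\ seqlen s n.
Proof.
  set (low := fun x => exists d, d < n /\ d el D /\ pair x d el R).
  set (phi := fun z => exists x, x < n /\
    ((low x /\ z = pair x 1) \/ (~ low x /\ z = pair x 0))).
  destruct (comprehension phi) as [X HX].
  { pose proof DefT_pair. unfold phi, low. defn. }
  (* This bound exceeds every pair of an index below [n] and a value 0 or 1. *)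
  destruct (finite_coding X (pair n 1 + pair n 0)) as [s [Hs Es]].
  assert (E : forall z, felem z s <-> phi z).
  { intros z. rewrite Es, HX. split; [tauto|]. intros Hz. split; auto.
    destruct Hz as [x [Hx [[_ ->]|[_ ->]]]].
    - apply lt_le_trans with (pair n 1); [now apply pair_lt_l|].
      apply lt_succ_iff. now exists (pair n 0).
    - apply lt_le_trans with (pair n 0); [now apply pair_lt_l|].
      apply lt_succ_iff. exists (pair n 1). apply add_comm. }
  clear X HX Es.
  assert (E1 : forall x, felem (pair x 1) s <-> x < n /\ low x).
  { intros x. rewrite E. split.
    - intros [x' [Hx [[Hl H]|[_ H]]]]; apply pair_inj in H as [-> H]; [auto|].
      now apply one_neq_0 in H.
    - intros [Hx Hl]. exists x. auto. }
  assert (E0 : forall x, (exists j, felem (pair x j) s) <-> x < n).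
  { intros x. split.
    - intros [j H]. apply E in H as [x' [Hx [[_ H]|[_ H]]]]; now apply pair_inj in H as [-> _].
    - intros Hx. destruct (classic (low x)) as [Hl|Hl].
      + exists 1. apply E. exists x. auto.
      + exists 0. apply E. exists x. auto. }
  exists s. split; [split; [split; [auto|split; [|split]]|]|split; [split; [|split; [|split]]|]].
  - intros z Hz. apply E in Hz as [x [_ [[_ ->]|[_ ->]]]]; eauto.
  - intros i j k [Hj Hk]. apply E in Hj as [x [_ Hj]]. apply E in Hk as [x' [_ Hk]].
    destruct Hj as [[Hl Hj]|[Hl Hj]], Hk as [[Hl' Hk]|[Hl' Hk]];
      apply pair_inj in Hj as [-> ->]; apply pair_inj in Hk as [-> ->]; tauto.
  - exists n. intros i. symmetry. apply E0.
  - intros i j Hj. apply E in Hj as [x [_ [[_ Hj]|[_ Hj]]]]; apply pair_inj in Hj as [_ ->]; auto.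
  - intros x y HR Hy Hx. apply E1. split; [now apply E0|].
    apply E1 in Hy as [_ [d [Hd [HD Hyd]]]]. exists d. eauto.
  - intros x HD Hx. apply E0 in Hx. apply E1. split; auto. exists x. auto.
  (* If x lay below some d' in D, so would d; then d = d' as D is an antichain, and x = d by
     antisymmetry. *)
  - intros d x HD Hdx HR _ Hx. apply E1 in Hx as [_ [d' [_ [HD' Hxd]]]].
    apply Hdx. destruct (classic (d = d')) as [<-|Hdd]; [auto|].
    exfalso. apply (proj1 (D_anti d d' (conj HD (conj HD' Hdd)))). eauto.
  - intros x Hx. apply E1 in Hx as [_ [d [_ [_ HR]]]]. now apply R_dom in HR.
  - intros i. symmetry. apply E0.
Qed.

Lemma separating_interval : exists I,
  (forall x, x el I -> x el P) /\
  (forall x y, pair x y el R /\ y el I -> x el I) /\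
  (forall x, x el D -> x el I) /\
  (forall d x, d el D -> x el I -> pair d x el R -> d = x).
Proof.
  destruct (comprehension (fun s => binseq s /\ approx s)) as [T HT].
  { pose proof Def0_binseq. pose proof Def0_approx. defn. }
  destruct (weak_koenig_model T) as [g [[_ [Htot Hfun]] Hpath]].
  - intros s Hs. now apply HT in Hs.
  (* [s] is single-valued, so [t] agrees with it on its own domain, and the conditions pass from [s]
     to [t]. *)
  - intros s t [Hs [Ht Hsub]]. apply HT in Hs as [[[_ [_ [Hs _]]] _] [Ha [Hb [Hc Hd]]]].
    apply HT. split; [auto|].
    assert (Hone : forall x, (exists j, felem (pair x j) t) -> felem (pair x 1) s ->
      felem (pair x 1) t).
    { intros x [j Hj] H1. replace 1 with j; auto. apply (Hs x). auto. }
    assert (Hdom : forall x, (exists j, felem (pair x j) t) -> exists j, felem (pair x j) s).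
    { intros x [j Hj]. eauto. }
    split; [|split; [|split]].
    + intros x y HR Hy Hx. apply Hone; auto. eapply Ha; eauto.
    + intros x HD Hx. apply Hone; auto.
    + intros d x HD Hdx HR Hd' Hx. apply (Hc d x); auto.
    + auto.
  (* A sequence of length k + 1 has an entry at index k, so its code exceeds k. *)
  - intros [k Hk]. destruct (approx_exists (k + 1)) as [s [Hs [Ha Hl]]].
    assert (Hsk : s < k) by (apply Hk, HT; auto).
    destruct (proj1 (Hl k) (lt_succ_diag k)) as [j Hj]. apply felem_pair_l in Hj.
    apply (lt_irrefl k). eapply lt_trans; eauto.
  - destruct (comprehension (fun x => pair x 1 el g)) as [I HI].
    { pose proof DefT_pair. defn. }
    (* Each condition on [I] involves at most two elements and is read off from a restriction of the
       path defined at all of them. *)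
    assert (Happ : forall b, exists s, approx s /\
      (forall x, x < b -> exists j, felem (pair x j) s) /\
      (forall x, x < b -> felem (pair x 1) s <-> x el I)).
    { intros b. destruct (Hpath b) as [s [[_ [Hl Hg]] HsT]]. exists s.
      apply HT in HsT as [_ Ha]. split; [auto|]. split; [intros x; apply Hl|].
      intros x Hx. rewrite HI. split; [auto|]. intros H1.
      destruct (proj1 (Hl x) Hx) as [j Hj]. replace 1 with j; [auto|].
      apply (Hfun x). auto. }
    assert (Hr : forall x y, y < x + y + 1).
    { intros x y. rewrite (add_comm x y). apply lt_add_r. }
    exists I. split; [|split; [|split]].
    + intros x Hx. destruct (Happ (x + 1)) as [s [[_ [_ [_ Hd]]] [_ Es]]].
      apply Hd, Es; auto using lt_succ_diag.
    + intros x y [HR Hy]. destruct (Happ (x + y + 1)) as [s [[Ha _] [Hdom Es]]].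
      apply Es; [apply lt_add_r|]. apply (Ha x y); [auto| |].
      * apply Es; auto.
      * apply Hdom, lt_add_r.
    + intros x HD. destruct (Happ (x + 1)) as [s [[_ [Hb _]] [Hdom Es]]].
      apply Es; [apply lt_succ_diag|]. apply Hb; auto. apply Hdom, lt_succ_diag.
    + intros d x HD Hx HR. apply NNPP. intros Hdx.
      destruct (Happ (d + x + 1)) as [s [[_ [_ [Hc _]]] [Hdom Es]]].
      apply (Hc d x); auto; [apply Hdom, lt_add_r|]. apply Es; auto.
Qed.

(* An ideal inside the separating interval contains at most one element of [D]. *)
Lemma ideal_cover_bounds_antichain I k A :
  (forall x, x el D -> x el I) ->
  (forall d x, d el D -> x el I -> pair d x el R -> d = x) ->
  (forall i, i < k -> forall x y, pair x i el A /\ pair y i el A ->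
    exists z, pair z i el A /\ pair x z el R /\ pair y z el R) ->
  (forall x, x el I <-> exists i, i < k /\ pair x i el A) ->
  exists b, forall x, x el D -> x < b.
Proof.
  intros HDI HI Hdir HA.
  (* An ideal that misses D has no witness, whence the strong form of bounding. *)
  destruct (strong_bounding (fun i x => x el D /\ pair x i el A) k) as [b Hb].
  { pose proof DefT_pair. intros. defn. }
  exists b. intros x Hx.
  destruct (proj1 (HA x) (HDI x Hx)) as [i [Hi Hxi]].
  destruct (Hb i Hi) as [y [Hy [HyD Hyi]]]; [eauto|].
  destruct (Hdir i Hi x y (conj Hxi Hyi)) as [z [Hz [Hxz Hyz]]].
  assert (HzI : z el I) by (apply HA; eauto).
  rewrite (HI x z), <- (HI y z); auto.
Qed.

End Order.

End Arithmetic.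

Local Open Scope l2_scope.

Theorem theorem5p6 :
  provable WKL0
    (allS P R,
      partial_order P R ->
      (exS D, antichain P R D /\ infinite D) ->
      exS I, initial_interval P R (of_set I) /\
             ~ finite_union_of_ideals P R (of_set I)).
Proof.
  apply completeness. intros M HW rho sig.
  assert (HM : models M RCA0) by (intros A HA; now apply HW, WKL0_RCA0).
  (* Satisfaction of the sentence unfolds by conversion to a statement about [M], so its clauses can
     be introduced directly. *)
  intros P R [R_sub [R_refl [R_antisym R_trans]]] [D [[D_sub D_anti] D_inf]].
  destruct (separating_interval M HM (sig 0) HW P R D R_sub R_refl R_antisym R_trans
    D_sub D_anti) as [I [HIP [Hdown [HDI HI]]]].
  exists I. split; [split; assumption|].
  intros [k [A [Hideal HA]]]. apply D_inf.
  apply (ideal_cover_bounds_antichain M HM (sig 0) R D I k A HDI HI).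
  - intros i Hi. apply (Hideal i Hi).
  - exact HA.
Qed.
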